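(* Let $G$ be a hereditarily countably characteristically based profinite group. (a) The following conditions are equivalent: (i) $G$ is $\mathrm{Aut}_2$; (ii) $\mathrm{Comm}(G)_A$ is locally compact (which includes Hausdorff). (b) If conditions (i) and (ii) are satisfied, then $\mathrm{Comm}(G)_A$ is $\sigma$-compact. (c) Assume that $\mathrm{VZ}(G)=\{1\}$. Then both (i) and (ii) hold if and only if there exists an open subgroup $U$ of $G$ such that the index $[\mathrm{ICom}(U):\iota(U)]$ is countable.
   Context: ''Countable'' means finite or countably infinite. For a topological group $L$, $\mathrm{VZ}(L)=\{g\in L: \text{the centralizer of } g \text{ in } L \text{ is open}\}$. A profinite group is countably characteristically based if it has a countable base of neighborhoods of $1$ consisting of (topologically) characteristic open subgroups, and hereditarily countably characteristically based (h.c.c.b.) if every open subgroup is countably characteristically based. For a profinite group $U$, $\mathrm{Aut}(U)$ is the group of continuous automorphisms, with the standard topology: a base of neighborhoods of $1$ is given by the sets $A(O)=\{\gamma\in\mathrm{Aut}(U):\gamma(g)\equiv g \bmod O \text{ for all } g\in U\}$, $O$ an open subgroup of $U$. $\mathrm{TAut}(U)$ is the subgroup of those automorphisms which fix pointwise some open subgroup of $U$. Commensurator of a profinite group $G$: a virtual automorphism of $G$ is a topological isomorphism between two open subgroups of $G$; two are equivalent if they coincide on some open subgroup; the equivalence classes form, under composition (after restricting to suitable open subgroups), a group $\mathrm{Comm}(G)$. For an open subgroup $U$ of $G$, $\mathrm{Comm}(U)$ is identified with $\mathrm{Comm}(G)$; $\iota_U:U\to\mathrm{Comm}(G)$ sends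 $g$ to the class of $x\mapsto gxg^{-1}$, $\iota(U)$ is its image, and $\mathrm{ICom}(U)$ is the normal subgroup of $\mathrm{Comm}(U)=\mathrm{Comm}(G)$ generated by $\iota(U)$. The homomorphism $\rho_U:\mathrm{Aut}(U)\to\mathrm{Comm}(G)$ sends an automorphism to its class; its kernel is $\mathrm{TAut}(U)$, and its image $\underline{\mathrm{Aut}}(U)\cong\mathrm{Aut}(U)/\mathrm{TAut}(U)$ carries the quotient topology. For h.c.c.b. $G$, $\mathrm{Comm}(G)_A$ denotes $\mathrm{Comm}(G)$ with the Aut-topology: the unique group topology for which the set of all subgroups $H\le\mathrm{Comm}(G)$ such that $\rho_O^{-1}(H)$ is open in $\mathrm{Aut}(O)$ for every open subgroup $O$ of $G$ is a base of neighborhoods of $1$. $G$ is $\mathrm{Aut}_1$ if $\mathrm{TAut}(U)$ is closed in $\mathrm{Aut}(U)$ for every open subgroup $U$ of $G$. For open subgroups $V\subseteq U$ of $G$, let $\mathrm{Aut}(U)_V=\{\alpha\in\mathrm{Aut}(U):\alpha(V)=V\}$, and let $\underline{\mathrm{Aut}}(U)_V=\rho_U(\mathrm{Aut}(U)_V)$, which is contained in $\underline{\mathrm{Aut}}(V)$. An open subgroup $U$ of $G$ is $\mathrm{Aut}$-stable if $\underline{\mathrm{Aut}}(U)_V$ is open in $\underline{\mathrm{Aut}}(V)$ for every open subgroup $V$ of $U$. $G$ is $\mathrm{Aut}_2$ if $G$ is $\mathrm{Aut}_1$ and some open subgroup of $G$ is $\mathrm{Aut}$-stable. *)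

(* Defs.v *)
From HB Require Import structures.
From mathcomp Require Import all_boot all_classical.
From mathcomp Require Import topology.

Set Implicit Arguments.
Unset Strict Implicit.
Unset Printing Implicit Defensive.

Local Open Scope classical_set_scope.
Local Open Scope quotient_scope.
Local Open Scope group_scope.

HB.mixin Record isTopologicalGroup G & Topological G & Group G := {
  mulg_continuous : continuous (fun xy : G * G => xy.1 * xy.2) ;
  invg_continuous : continuous (fun x : G => x^-1)
}.

#[short(type="topologicalGroupType")]
HB.structure Definition TopologicalGroup :=
  {G of isTopologicalGroup G & Topological G & Group G}.

Definition profinite (G : topologicalGroupType) : Prop :=
  [/\ compact [set: G], hausdorff_space G & totally_disconnected [set: G]].

Section Subgroups.
Context {L : groupType}.
Implicit Types H K : set L.

Definition is_subgroup H : Prop := group_closed [in H].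

Lemma is_subgroupP H :
  is_subgroup H <-> H 1 /\ (forall x y, H x -> H y -> H (x / y)).
Proof.
have HE x : (x \in [in H]) = (x \in H) by [].
split=> [[H1 HB]|[H1 HB]]; split.
- by move: H1; rewrite HE => /set_mem.
- by move=> x y /mem_set Hx /mem_set Hy; have := HB x y Hx Hy => /set_mem.
- by rewrite HE; apply: mem_set.
- by move=> x y /set_mem Hx /set_mem Hy; rewrite HE; apply/mem_set/HB.
Qed.

Lemma subgroup1 H : is_subgroup H -> H 1.
Proof. by case/is_subgroupP. Qed.

Lemma subgroupV H x : is_subgroup H -> H x -> H x^-1.
Proof. by case/is_subgroupP=> H1 HB Hx; rewrite -[x^-1]mul1g; apply: HB. Qed.

Lemma subgroupM H x y : is_subgroup H -> H x -> H y -> H (x * y).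
Proof.
move=> sH Hx Hy; rewrite -[y]invgK; case/is_subgroupP: (sH) => _; apply=> //.
exact: subgroupV.
Qed.

Lemma subgroupI H K : is_subgroup H -> is_subgroup K -> is_subgroup (H `&` K).
Proof.
move=> /is_subgroupP[H1 HB] /is_subgroupP[K1 KB]; apply/is_subgroupP.
by split=> // x y [? ?] [? ?]; split; [apply: HB|apply: KB].
Qed.

Lemma subgroupT : is_subgroup [set: L].
Proof. by apply/is_subgroupP. Qed.

Definition is_normal H : Prop :=
  is_subgroup H /\ forall g x, H x -> H (g * x * g^-1).

Definition normal_closure (S : set L) : set L :=
  \bigcap_(N in [set N | is_normal N /\ S `<=` N]) N.

Definition lcoset (x : L) H : set L := [set x * h | h in H].

Definition countable_index K H : Prop :=
  countable [set lcoset x H | x in K].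

End Subgroups.

Definition VZ (L : topologicalGroupType) : set L :=
  [set g | open [set h : L | commute g h]].

Arguments VZ : clear implicits.

Section OpenSubgroups.
Context (G : topologicalGroupType).

Record openSubgroup := OpenSubgroup {
  os_set :> set G ;
  os_subgroup : is_subgroup os_set ;
  os_open : open os_set
}.

Definition osT : openSubgroup := OpenSubgroup subgroupT openT.

Definition osI (U V : openSubgroup) : openSubgroup :=
  OpenSubgroup (subgroupI (os_subgroup U) (os_subgroup V))
               (openI (os_open U) (os_open V)).

Lemma os1 (U : openSubgroup) : os_set U 1.
Proof. exact: subgroup1 (os_subgroup U). Qed.

Lemma osV (U : openSubgroup) x : os_set U x -> os_set U x^-1.
Proof. exact: subgroupV (os_subgroup U). Qed.

Lemma osM (U : openSubgroup) x y : os_set U x -> os_set U y -> os_set U (x * y).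
Proof. exact: subgroupM (os_subgroup U). Qed.

End OpenSubgroups.

Section TopologicalIsomorphisms.
Context {G : topologicalGroupType}.
Implicit Types A B C : set G.

Definition top_hom A B (f : G -> G) : Prop :=
  [/\ set_fun A B f, (forall x y, A x -> A y -> f (x * y) = f x * f y)
    & {within A, continuous f}].

Definition top_inverse A B (f g : G -> G) : Prop :=
  [/\ top_hom A B f, top_hom B A g,
      (forall x, A x -> g (f x) = x) & (forall y, B y -> f (g y) = y)].

(* [f] restricts to a topological isomorphism from [A] onto [B]; its values
   outside [A] are irrelevant. *)
Definition top_iso A B (f : G -> G) : Prop := exists g, top_inverse A B f g.

Lemma top_inverse_sym A B f g : top_inverse A B f g -> top_inverse B A g f.
Proof. by case. Qed.

Lemma top_hom1 (A : openSubgroup G) B f : top_hom A B f -> f 1 = 1.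
Proof.
case=> _ fM _; apply: (@mulgI _ (f 1)).
by rewrite -fM ?mulg1//; exact: os1.
Qed.

Lemma top_homV (A : openSubgroup G) B f x :
  top_hom A B f -> os_set A x -> f x^-1 = (f x)^-1.
Proof.
move=> hf Ax; have [_ fM _] := hf; apply: (@mulgI _ (f x)).
rewrite -fM ?mulgV ?(top_hom1 hf)//.
exact: osV.
Qed.

Lemma preim_subgroup (A B : openSubgroup G) C f : top_hom A C f ->
  is_subgroup [set x | os_set A x /\ os_set B (f x)].
Proof.
move=> hf; have [_ fM _] := hf; apply/is_subgroupP; split.
  by split; rewrite ?(top_hom1 hf); exact: os1.
move=> x y [Ax Bx] [Ay By]; have Ay' := osV Ay; split; first exact: osM.
by rewrite fM// (top_homV hf)//; apply/osM/osV.
Qed.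

Lemma preim_open (A B : openSubgroup G) C f : top_hom A C f ->
  open [set x | os_set A x /\ os_set B (f x)].
Proof.
move=> [_ _]; rewrite continuous_open_subspace; last exact: os_open.
by move/(continuous_inP _ (os_open A)); apply; exact: os_open.
Qed.

Definition os_preim (A B : openSubgroup G) C f (hf : top_hom A C f) :
  openSubgroup G := OpenSubgroup (preim_subgroup B hf) (preim_open B hf).

Lemma top_hom_restr A A' B B' f : A' `<=` A -> set_fun A' B' f ->
  top_hom A B f -> top_hom A' B' f.
Proof.
move=> sA mf [_ fM fc]; split=> //; first by move=> x y /sA ? /sA; exact: fM.
exact: continuous_subspaceW fc.
Qed.

Lemma top_hom_comp A B B' C f g : open A -> open B' -> B `<=` B' ->
  top_hom A B f -> top_hom B' C g -> top_hom A C (g \o f).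
Proof.
move=> oA oB' sB [mf fM fc] [mg gM gc]; split.
- by move=> x Ax; apply/mg/sB/mf.
- by move=> x y Ax Ay /=; rewrite fM// gM//; apply/sB/mf.
- move: fc gc; rewrite !continuous_open_subspace//.
  move=> /(continuous_inP _ oA) fc /(continuous_inP _ oB') gc.
  apply/(continuous_inP _ oA) => X /gc/fc; congr open.
  apply/seteqP; split=> x /= [Ax]; first by case.
  by move=> Xx; split=> //; split=> //; apply/sB/mf.
Qed.

Lemma top_inverse_id A : top_inverse A A id id.
Proof.
have h : top_hom A A id.
  by split=> //; apply: continuous_subspaceT => x; exact: cvg_id.
by split.
Qed.

End TopologicalIsomorphisms.

(* [Aut U], with the topology for which the sets
   [A(O) = {c | c g = g mod O for all g in U}], [O] an open subgroup of [U],
   form a base of neighborhoods of the identity: [aut_ball a O] is the right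
   translate [A(O) \o a].  Automorphisms of [U] are extended by the identity
   outside [U], so that equality in [Aut U] is equality of automorphisms. *)
Section ContinuousAutomorphisms.
Context {G : topologicalGroupType} (U : openSubgroup G).

Record Aut := MkAut {
  aut_fun :> G -> G ;
  aut_iso : top_iso U U aut_fun ;
  aut_out : forall x, ~ os_set U x -> aut_fun x = x
}.

HB.instance Definition _ := gen_eqMixin Aut.
HB.instance Definition _ := gen_choiceMixin Aut.

Lemma autP (a b : Aut) : (forall x, os_set U x -> a x = b x) -> a = b.
Proof.
case: a b => [f fi fo] [g gi go] /= fg.
have {}fg : f = g.
  by apply: funext => x; have [/fg//|nUx] := pselect (os_set U x); rewrite fo ?go.
by subst g; congr MkAut; exact: Prop_irrelevance.
Qed.

Definition aut_ball (a : Aut) (O : set G) : set Aut :=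
  [set b | forall g, os_set U g -> O ((a g)^-1 * b g)].

Definition aut_nbhs (a : Aut) : set_system Aut :=
  filter_from [set O : openSubgroup G | O `<=` U] (fun O => aut_ball a O).

Lemma aut_ball_refl (a : Aut) (O : openSubgroup G) : aut_ball a O a.
Proof. by move=> g _; rewrite mulVg; exact: os1. Qed.

Lemma aut_ball_trans (a b c : Aut) (O : openSubgroup G) :
  aut_ball a O b -> aut_ball b O c -> aut_ball a O c.
Proof.
move=> ab bc g Ug; have := osM (ab g Ug) (bc g Ug).
by rewrite -mulgA mulVKg.
Qed.

HB.instance Definition _ := hasNbhs.Build Aut aut_nbhs.

Lemma aut_nbhs_filter (a : Aut) : ProperFilter (nbhs a).
Proof.
apply: filter_from_proper; last by move=> O _; exists a; exact: aut_ball_refl.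
apply: filter_from_filter; first by exists U => /=.
move=> O P OU PU; exists (osI O P); first by move=> x [/OU].
by move=> b ab; split=> g /ab[].
Qed.

Lemma aut_nbhs_singleton (a : Aut) (A : set Aut) : nbhs a A -> A a.
Proof. by case=> O _; apply; exact: aut_ball_refl. Qed.

Lemma aut_nbhs_nbhs (a : Aut) (A : set Aut) : nbhs a A -> nbhs a (nbhs^~ A).
Proof.
case=> O OU sA; exists O => // b ab; exists O => // c bc.
exact/sA/(aut_ball_trans ab).
Qed.

HB.instance Definition _ := Nbhs_isNbhsTopological.Build Aut
  aut_nbhs_filter aut_nbhs_singleton aut_nbhs_nbhs.

Definition TAut : set Aut :=
  [set a | exists W : openSubgroup G,
     W `<=` U /\ forall x, os_set W x -> a x = x].

Definition Aut_stab (V : set G) : set Aut := [set a | a @` V = V].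

Definition char_open (C : openSubgroup G) : Prop :=
  C `<=` U /\ forall a : Aut, a @` C = C.

Definition ccb : Prop := exists B : set (openSubgroup G),
  [/\ countable B, B `<=` char_open
    & forall W, nbhs (1 : G) W -> exists2 C : openSubgroup G, B C & C `<=` W].

End ContinuousAutomorphisms.

Arguments Aut {G} U.

Definition hccb (G : topologicalGroupType) : Prop :=
  forall U : openSubgroup G, ccb U.

Section Commensurator.
Context {G : topologicalGroupType}.

Record virtAut := VirtAut {
  va_dom : openSubgroup G ;
  va_cod : openSubgroup G ;
  va_fun :> G -> G ;
  va_iso : top_iso va_dom va_cod va_fun
}.

HB.instance Definition _ := gen_eqMixin virtAut.
HB.instance Definition _ := gen_choiceMixin virtAut.

Definition va_equiv (v w : virtAut) : Prop :=
  exists W : openSubgroup G, [/\ W `<=` va_dom v, W `<=` va_dom w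
    & forall x, os_set W x -> v x = w x].

Lemma va_equiv_refl v : va_equiv v v.
Proof. by exists (va_dom v); split. Qed.

Lemma va_equiv_sym v w : va_equiv v w -> va_equiv w v.
Proof. by move=> [W [? ? vw]]; exists W; split=> // x /vw. Qed.

Lemma va_equiv_trans v w u : va_equiv v w -> va_equiv w u -> va_equiv v u.
Proof.
move=> [W [Wv Ww vw]] [W' [W'w W'u wu]]; exists (osI W W').
by split=> [x [/Wv]|x [_ /W'u]|x [/vw-> /wu]].
Qed.

Definition va_eqb (v w : virtAut) : bool := `[< va_equiv v w >].

Lemma va_eqb_equiv : equiv_class_of va_eqb.
Proof.
split=> [v|v w|w v u]; first exact/asboolP/va_equiv_refl.
- by apply/asboolP/asboolP; exact: va_equiv_sym.
- by move=> /asboolP vw /asboolP wu; apply/asboolP/(va_equiv_trans vw).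
Qed.

Canonical va_equivR := EquivRelPack va_eqb_equiv.

Definition Comm := {eq_quot va_equivR}.

HB.instance Definition _ := Choice.on Comm.
HB.instance Definition _ := EqQuotient.on Comm.

Definition comm_class (v : virtAut) : Comm := \pi v.

Lemma comm_classP v w : comm_class v = comm_class w <-> va_equiv v w.
Proof. by split=> [/eqmodP/asboolP|?]; last by apply/eqmodP/asboolP. Qed.

Lemma comm_classK (c : Comm) : comm_class (repr c) = c.
Proof. exact: reprK. Qed.

Definition va_id : virtAut :=
  @VirtAut (osT G) (osT G) id (ex_intro _ id (top_inverse_id _)).

Definition va_invfun (v : virtAut) : G -> G := projT1 (cid (va_iso v)).

Lemma va_invfunP v : top_inverse (va_dom v) (va_cod v) v (va_invfun v).
Proof. exact: projT2 (cid (va_iso v)). Qed.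

Definition va_inv (v : virtAut) : virtAut :=
  VirtAut (ex_intro _ _ (top_inverse_sym (va_invfunP v))).

Lemma va_hom (v : virtAut) : top_hom (va_dom v) (va_cod v) v.
Proof. by case: (va_invfunP v). Qed.

Lemma va_invhom (v : virtAut) : top_hom (va_cod v) (va_dom v) (va_invfun v).
Proof. by case: (va_invfunP v). Qed.

Definition comp_dom (v w : virtAut) : openSubgroup G :=
  os_preim (va_dom v) (va_hom w).

Definition comp_cod (v w : virtAut) : openSubgroup G :=
  os_preim (va_cod w) (va_invhom v).

Lemma comp_iso v w : top_iso (comp_dom v w) (comp_cod v w) (v \o w).
Proof.
have [hv hv' vK vK'] := va_invfunP v; have [hw hw' wK wK'] := va_invfunP w.
have [[mv _ _] [mv' _ _] [mw _ _] [mw' _ _]] := And4 hv hv' hw hw'.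
have comp (A B B' C : openSubgroup G) f g (hf : top_hom A B f)
  (hg : top_hom B' C g) : top_hom (os_preim B' hf) C (g \o f).
  apply: (@top_hom_comp _ _ (B `&` B') B' _ f g) => //; try exact: os_open.
  apply: (top_hom_restr _ _ (hf)); first by move=> x [].
  by have [mf _ _] := hf; move=> x [Ax B'x]; split=> //; exact: mf.
exists (va_invfun w \o va_invfun v); split.
- apply: top_hom_restr (comp _ _ _ _ _ _ hw hv) => // x [wx vx]; split=> /=.
    exact: mv.
  by rewrite vK//; exact: mw.
- apply: top_hom_restr (comp _ _ _ _ _ _ hv' hw') => // x [vx wx]; split=> /=.
    exact: mw'.
  by rewrite wK'//; exact: mv'.
- by move=> x [Ax Bx] /=; rewrite vK// wK.
- by move=> x [Ax Bx] /=; rewrite wK'// vK'.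
Qed.

Definition va_comp (v w : virtAut) : virtAut := VirtAut (comp_iso v w).

Lemma va_comp_equiv v v' w w' :
  va_equiv v v' -> va_equiv w w' -> va_equiv (va_comp v w) (va_comp v' w').
Proof.
move=> [A [Av Av' vv']] [B [Bw Bw' ww']].
have hB : top_hom B (va_cod w) w.
  have [mw _ _] := va_hom w.
  by apply: top_hom_restr (va_hom w) => // x /Bw; exact: mw.
exists (os_preim A hB); split=> x [Bx Awx] /=.
- by split; [exact: Bw|exact: Av].
- by split; [exact: Bw'|rewrite -ww'//; exact: Av'].
- by rewrite -ww'// vv'.
Qed.

Lemma va_inv_equiv v w : va_equiv v w -> va_equiv (va_inv v) (va_inv w).
Proof.
move=> [A [Av Aw vw]]; exists (os_preim A (va_invhom v)).
have [[mv _ _] [mv' _ _] vK vK'] := va_invfunP v.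
have [[mw _ _] [mw' _ _] wK wK'] := va_invfunP w.
have key x : os_set (va_cod v) x -> os_set A (va_invfun v x) ->
    x = w (va_invfun v x).
  by move=> vx Ax; rewrite -vw// vK'.
split=> x [vx Ax] //=; first by rewrite (key x)//; apply/mw/Aw.
by rewrite {2}(key x)// wK//; exact: Aw.
Qed.

Definition comm_one : Comm := comm_class va_id.
Definition comm_mul (c d : Comm) : Comm := comm_class (va_comp (repr c) (repr d)).
Definition comm_inv (c : Comm) : Comm := comm_class (va_inv (repr c)).

Lemma comm_mulE v w :
  comm_mul (comm_class v) (comm_class w) = comm_class (va_comp v w).
Proof.
by apply/comm_classP/va_comp_equiv; apply/comm_classP; rewrite comm_classK.
Qed.

Lemma comm_invE v : comm_inv (comm_class v) = comm_class (va_inv v).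
Proof. by apply/comm_classP/va_inv_equiv/comm_classP; rewrite comm_classK. Qed.

Lemma comm_mulA : associative comm_mul.
Proof.
move=> a b c; rewrite -[a]comm_classK -[b]comm_classK -[c]comm_classK.
rewrite !comm_mulE; apply/comm_classP.
exists (va_dom (va_comp (repr a) (va_comp (repr b) (repr c)))).
by split=> // x [[? ?] ?].
Qed.

Lemma comm_mul1 : left_id comm_one comm_mul.
Proof.
move=> a; rewrite -[a]comm_classK comm_mulE; apply/comm_classP.
by exists (va_dom (va_comp va_id (repr a))); split=> // x [].
Qed.

Lemma comm_mulr1 : right_id comm_one comm_mul.
Proof.
move=> a; rewrite -[a]comm_classK comm_mulE; apply/comm_classP.
by exists (va_dom (va_comp (repr a) va_id)); split=> // x [].
Qed.

Lemma comm_mulV : left_inverse comm_one comm_inv comm_mul.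
Proof.
move=> a; rewrite -[a]comm_classK comm_invE comm_mulE; apply/comm_classP.
exists (va_dom (va_comp (va_inv (repr a)) (repr a))); split=> // x [ax _] /=.
by have [_ _ -> //] := va_invfunP (repr a).
Qed.

Lemma comm_mulrV : right_inverse comm_one comm_inv comm_mul.
Proof.
move=> a; rewrite -[a]comm_classK comm_invE comm_mulE; apply/comm_classP.
exists (va_dom (va_comp (repr a) (va_inv (repr a)))); split=> // x [ax _] /=.
by have [_ _ _ -> //] := va_invfunP (repr a).
Qed.

HB.instance Definition _ := isGroup.Build Comm
  comm_mulA comm_mul1 comm_mulr1 comm_mulV comm_mulrV.

End Commensurator.

Arguments virtAut : clear implicits.
Arguments Comm : clear implicits.

Section AutTopology.
Context {G : topologicalGroupType}.

Definition rho (U : openSubgroup G) (a : Aut U) : Comm G :=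
  comm_class (VirtAut (aut_iso a)).

Lemma rho_eq1 (U : openSubgroup G) (a : Aut U) : rho a = 1 <-> TAut a.
Proof.
split=> [/comm_classP[W [/= WU _ aW]]|[W [WU aW]]]; first by exists W.
by apply/comm_classP; exists W.
Qed.

Lemma inner_iso (g : G) :
  top_iso [set: G] [set: G] (fun x => g * x * g^-1).
Proof.
have hom h : top_hom [set: G] [set: G] (fun x => h * x * h^-1).
  split=> [//|x y _ _|]; first by rewrite !mulgA mulgVK.
  apply: continuous_subspaceT => x.
  have mc (f f' : G -> G) : {for x, continuous f} -> {for x, continuous f'} ->
      {for x, continuous (fun y => f y * f' y)}.
    move=> cf cf'; apply: (@continuous_comp _ _ _ (fun y => (f y, f' y))
      (fun xy : G * G => xy.1 * xy.2)); last exact: mulg_continuous.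
    exact: cvg_pair cf cf'.
  by apply: (mc (fun y => h * y)); [apply: (mc (fun=> h))|];
    first [exact: cvg_cst|exact: cvg_id].
exists (fun x => g^-1 * x * (g^-1)^-1); split=> // x _.
- by rewrite invgK !mulgA mulVg mul1g mulgVK.
- by rewrite invgK !mulgA mulgV mul1g mulgK.
Qed.

Definition inner (g : G) : virtAut G :=
  @VirtAut _ (osT G) (osT G) _ (inner_iso g).

Definition iota_comm (g : G) : Comm G := comm_class (inner g).

Definition ICom (U : openSubgroup G) : set (Comm G) := normal_closure (iota_comm @` U).

Definition aut_base : set (set (Comm G)) :=
  [set H | is_subgroup H /\
     forall O : openSubgroup G, open ((@rho O) @^-1` H)].

End AutTopology.

(* The Aut-topology: the neighborhoods of [c] are the translates [c H] of the
   subgroups in [aut_base].  For any [G] this is a topology; [commA_mul] and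
   [commA_inv] below show that it is a group topology when [G] is [hccb]. *)
Definition CommA (G : topologicalGroupType) : Type := Comm G.

Section CommATopology.
Context {G : topologicalGroupType}.

HB.instance Definition _ := Group.on (CommA G).

Definition commA_nbhs (c : CommA G) : set_system (CommA G) :=
  filter_from (@aut_base G) (lcoset (c : Comm G)).

HB.instance Definition _ := hasNbhs.Build (CommA G) commA_nbhs.

Lemma aut_baseT : aut_base [set: Comm G].
Proof. by split=> [|O]; [exact: subgroupT|rewrite preimage_setT; exact: openT]. Qed.

Lemma aut_baseI H K : aut_base H -> aut_base K -> @aut_base G (H `&` K).
Proof.
move=> [sH oH] [sK oK]; split; first exact: subgroupI.
by move=> O; rewrite preimage_setI; apply: openI.
Qed.

Lemma lcoset_refl (L : groupType) (H : set L) x : is_subgroup H -> lcoset x H x.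
Proof. by move=> sH; exists 1; [exact: subgroup1|rewrite mulg1]. Qed.

Lemma lcoset_trans (L : groupType) (H : set L) x y :
  is_subgroup H -> lcoset x H y -> lcoset y H `<=` lcoset x H.
Proof.
move=> sH [h Hh <-] _ [k Hk <-]; exists (h * k); last by rewrite mulgA.
exact: subgroupM.
Qed.

Lemma commA_nbhs_filter (c : CommA G) : ProperFilter (nbhs c).
Proof.
apply: filter_from_proper; last first.
  by move=> H [sH _]; exists c; exact: lcoset_refl.
apply: filter_from_filter; first by exists setT; exact: aut_baseT.
move=> H K bH bK; exists (H `&` K); first exact: aut_baseI.
by move=> _ [h [Hh Kh] <-]; split; exists h.
Qed.

Lemma commA_nbhs_singleton (c : CommA G) A : nbhs c A -> A c.
Proof. by case=> H [sH _]; apply; exact: lcoset_refl. Qed.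

Lemma commA_nbhs_nbhs (c : CommA G) A : nbhs c A -> nbhs c (nbhs^~ A).
Proof.
case=> H bH cA; exists H => // d cd; exists H => //.
by apply: subset_trans cA; apply: lcoset_trans cd; case: bH.
Qed.

HB.instance Definition _ := Nbhs_isNbhsTopological.Build (CommA G)
  commA_nbhs_filter commA_nbhs_singleton commA_nbhs_nbhs.

End CommATopology.

Section CommAGroup.
Context {G : topologicalGroupType}.

Lemma top_hom_eq (A : openSubgroup G) B f f' :
  (forall x, os_set A x -> f x = f' x) ->
  top_hom A B f -> top_hom A B f'.
Proof.
move=> ff' [mf fM fc]; split; first by move=> x Ax; rewrite -ff'//; exact: mf.
- by move=> x y Ax Ay; rewrite -!ff'//; [exact: fM|exact: osM].
- by apply: subspace_eq_continuous fc => x /set_mem /ff'.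
Qed.

Section Conjugation.
Variables (v : virtAut G) (O C : openSubgroup G).
Hypotheses (charC : char_open O C) (Cv : C `<=` va_cod v).

Let M : openSubgroup G := os_preim C (va_hom v).

Lemma conj_hom (f g : G -> G) : top_inverse O O f g -> set_fun C C f ->
  top_hom M M (va_invfun v \o f \o v).
Proof.
move=> [hf _ _ _] fC; have [CO _] := charC.
have [hv hv' vK vK'] := va_invfunP v.
have hM : top_hom M C v by apply: top_hom_restr hv => x [].
have hfC : top_hom C C f by exact: top_hom_restr hf.
have hC : top_hom C M (va_invfun v).
  have [mv' _ _] := hv'; apply: top_hom_restr hv' => // x Cx.
  by split; [exact/mv'/Cv|rewrite vK'//; exact: Cv].
have hfv : top_hom M C (f \o v).
  by apply: top_hom_comp hM hfC; try exact: os_open.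
by apply: top_hom_comp hfv hC; try exact: os_open.
Qed.

Lemma conj_aut (a : Aut O) :
  exists b : Aut M, forall x, os_set M x -> b x = va_invfun v (a (v x)).
Proof.
have [CO aC] := charC; have [hv hv' vK vK'] := va_invfunP v.
have [g ag] := aut_iso a; have [_ _ aK _] := ag.
have fC : set_fun C C a by move=> x Cx; rewrite /= -(aC a); exists x.
have gC : set_fun C C g.
  by move=> x; rewrite -{1}(aC a) => -[y Cy <-]; rewrite /= aK//; exact: CO.
have h1 := conj_hom ag fC; have h2 := conj_hom (top_inverse_sym ag) gC.
have K (f f' : G -> G) : set_fun C C f -> (forall x, os_set O x -> f' (f x) = x) ->
    forall x, os_set M x ->
    va_invfun v (f' (v (va_invfun v (f (v x))))) = x.
  move=> ffC ff' x [vx Cx].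
  by rewrite vK'; [rewrite ff' ?vK//; exact: CO|exact/Cv/ffC].
pose p f x : G := if pselect (os_set M x) then f x else x.
have pE f x : os_set M x -> p f x = f x by rewrite /p; case: pselect.
pose f := va_invfun v \o a \o v; pose f' := va_invfun v \o g \o v.
have iso : top_iso M M (p f).
  have [mf _ _] := h1; have [mf' _ _] := h2; have [_ _ _ gK] := ag.
  exists (p f'); split.
  - by apply: top_hom_eq h1 => x Mx; rewrite pE.
  - by apply: top_hom_eq h2 => x Mx; rewrite pE.
  - by move=> x Mx; rewrite (pE f)// pE; [exact: K Mx|exact: mf].
  - by move=> x Mx; rewrite (pE f')// pE; [exact: K Mx|exact: mf'].
have out x : ~ os_set M x -> p f x = x by rewrite /p; case: pselect.
by exists (MkAut iso out) => x Mx /=; rewrite pE.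
Qed.

Lemma rho_conj (a : Aut O) (b : Aut M) :
  (forall x, os_set M x -> b x = va_invfun v (a (v x))) ->
  rho b = (comm_class v)^-1 * rho a * comm_class v.
Proof.
move=> ba; rewrite [_^-1]comm_invE [_ * rho a]comm_mulE [RHS]comm_mulE.
have [CO aC] := charC.
apply/comm_classP; exists M; split=> // x [vx Cx]; split=> //=.
by split; [exact: CO|apply: Cv; rewrite -(aC a); exists (v x)].
Qed.

End Conjugation.

Lemma aut_base_conj (c : Comm G) H : hccb G -> aut_base H ->
  aut_base [set x | H (c^-1 * x * c)].
Proof.
move=> hG [sH oH]; split.
  have [H1 HB] := (is_subgroupP H).1 sH; apply/is_subgroupP; split=> /=.
    by rewrite mulg1 mulVg.
  move=> x y Hx Hy; have := HB _ _ Hx Hy.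
  by rewrite !invgM invgK !mulgA mulgK.
move=> O; rewrite openE => a /= Ha.
rewrite -[c]comm_classK in Ha *; set v := repr c in Ha *.
have [B [_ Bchar Bnbhs]] := hG O.
have [|C /Bchar charC Cv] := Bnbhs (va_cod v).
  by apply: open_nbhs_nbhs; split; [exact: os_open|exact: os1].
have [b ba] := conj_aut charC Cv a.
have := oH (os_preim C (va_hom v)).
rewrite openE => /(_ b) /=; rewrite (rho_conj charC Cv ba) => /(_ Ha).
case=> Q /= QM bQ; have hv' := va_invhom v.
have [_ _ vK vK'] := va_invfunP v; have [CO aC] := charC.
exists (os_preim Q hv') => /=.
  by move=> y [vy /QM[_ /=]]; rewrite vK'// => /CO.
move=> a' aa' /=; have [b' ba'] := conj_aut charC Cv a'.
rewrite -(rho_conj charC Cv ba'); apply: bQ => x Mx.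
rewrite ba// ba'//; have [vx Cx] := Mx.
have [_ /=] := aa' _ (CO _ Cx).
have Ca (d : Aut O) : os_set (va_cod v) (d (v x)).
  by apply: Cv; rewrite -(aC d); exists (v x).
have [_ v'M _] := hv'.
by rewrite v'M ?(top_homV hv')//; exact: osV.
Qed.

Lemma commA_mul : hccb G ->
  continuous (fun xy : CommA G * CommA G => xy.1 * xy.2).
Proof.
move=> hG [x y] W [H bH xyW] /=.
have bK := aut_base_conj y hG bH.
exists (lcoset x [set z | H (y^-1 * z * y)], lcoset y H).
  by split; [exists [set z | H (y^-1 * z * y)]|exists H].
move=> [_ _] [/= [k Hk <-] [h Hh <-]]; apply: xyW.
exists (y^-1 * k * y * h); first by apply: subgroupM => //; case: bH.
by rewrite !mulgA mulgK.
Qed.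

Lemma commA_inv : hccb G -> continuous (fun x : CommA G => x^-1).
Proof.
move=> hG x W [H bH xW]; have bK := aut_base_conj (x^-1) hG bH.
eexists; first exact: bK.
move=> _ [k Hk <-]; apply: xW; exists (x * k^-1 * x^-1).
  rewrite -[X in H X]invgK; apply: subgroupV; first by case: bH.
  by move: Hk; rewrite /= !invgM !invgK !mulgA.
by rewrite !mulgA mulVg mul1g invgM.
Qed.

End CommAGroup.

Definition Aut1 (G : topologicalGroupType) : Prop :=
  forall U : openSubgroup G, closed (@TAut G U).

Section AutStable.
Context {G : topologicalGroupType}.

Definition uAut (U : openSubgroup G) : set (Comm G) := range (@rho G U).

(* [uAut V] carries the quotient topology of [Aut V]. *)
Definition open_in_uAut (V : openSubgroup G) (S : set (Comm G)) : Prop :=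
  S `<=` uAut V /\ open ((@rho G V) @^-1` S).

Definition uAut_stab (U V : openSubgroup G) : set (Comm G) :=
  (@rho G U) @` Aut_stab V.

Definition Aut_stable (U : openSubgroup G) : Prop :=
  forall V : openSubgroup G, V `<=` U -> open_in_uAut V (uAut_stab U V).

End AutStable.

Definition Aut2 (G : topologicalGroupType) : Prop :=
  Aut1 G /\ exists U : openSubgroup G, Aut_stable U.

Definition sigma_compact (T : topologicalType) : Prop :=
  exists F : nat -> set T,
    (forall n, compact (F n)) /\ \bigcup_n F n = [set: T].

(* Main.v *)
(* Every [Aut U] is compact: along an ultrafilter, automorphisms converge
   pointwise, and characteristic open subgroups make the convergence
   uniform. There are only countably many open subgroups, so [Comm G] is the
   union of countably many sets of classes of isomorphisms between two given
   open subgroups [A] and [B], each empty or a coset of the compact group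
   [uAut A]. Hence [CommA G] is sigma-compact, and if it is Hausdorff and
   locally compact then some [uAut A] is open by Baire, whence [A] is
   Aut-stable. Conversely, let [U] be Aut-stable and [G] be Aut1. The
   congruence subgroups of [Aut U] have finite index, and their preimages in
   any [Aut C] are products of two compact groups, hence closed; so their
   images in [Comm G] are open, again by Baire. These images are compact
   with trivial intersection.

   For (c), all conjugates of [iota U] are commensurable with it, and
   [uAut U] normalizes it; when [uAut U] is open it has countable index, so
   [ICom U] is generated by countably many groups commensurable with
   [iota U]. Conversely, if [VZ G] is trivial then [uAut U] is the
   normalizer of [iota U]. If [iota U] has countable index in [ICom U] and
   [V] is an open subgroup of [U], the conjugates of [iota U] under [Aut V]
   are finite unions of cosets of [iota V] in [ICom U], so there are
   countably many of them; the stabilizer of [iota U] in [Aut V] is thus a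
   closed subgroup of countable index, and it is open by Baire. *)
From HB Require Import structures.
Require Import Defs.
From mathcomp Require Import all_boot finmap all_classical.
From mathcomp Require Import topology.

Set Implicit Arguments.
Unset Strict Implicit.
Unset Printing Implicit Defensive.

Local Open Scope classical_set_scope.
Local Open Scope group_scope.

(** * Baire category in topological groups *)

Lemma countableW T (A B : set T) : A `<=` B -> countable B -> countable A.
Proof. by move=> /subset_card_le; exact: sub_countable. Qed.

Lemma countable_image T U (f : T -> U) (A : set T) :
  countable A -> countable (f @` A).
Proof. exact/sub_countable/card_image_le. Qed.

(** On [X] the value of [F] is determined by that of [J], so an injection of the [J]-values into the
    integers also separates the [F]-values. Cosets and conjugates are counted through it. *)
Lemma countable_image_factor T U V (J : T -> U) (F : T -> V) (X : set T) :
  (forall x y, X x -> X y -> J x = J y -> F x = F y) ->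
  countable (J @` X) -> countable (F @` X).
Proof.
move=> JF /countable_injP[f finj]; apply/countable_injP.
(* A value [v] is coded through [J] at a chosen preimage; the value [0] off the image is
   arbitrary. *)
pose h v := if pselect (exists2 x, X x & F x = v) is left e
  then f (J (projT1 (cid2 e))) else 0.
exists h => v w; rewrite !inE => -[x Xx Fx] [y Xy Fy]; rewrite /h.
case: pselect => [e|]; last by case; exists x.
case: pselect => [e'|]; last by case; exists y.
case: (cid2 e) => /= x' Xx' <-; case: (cid2 e') => /= y' Xy' <- ff.
by apply: JF => //; apply: finj ff; rewrite inE; [exists x'|exists y'].
Qed.

Section Cosets.
Context {L : groupType}.
Implicit Types (H : set L) (x y : L).

Lemma lcosetE H x y : lcoset x H y <-> H (x^-1 * y).
Proof.
split=> [[h Hh <-]|Hxy]; first by rewrite mulKg.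
by exists (x^-1 * y); rewrite // mulVKg.
Qed.

Lemma subgroup_divC H x y : is_subgroup H -> H (x^-1 * y) -> H (y^-1 * x).
Proof. by move=> sH /(subgroupV sH); rewrite invgM invgK. Qed.

Lemma lcoset_eqP H x y : is_subgroup H ->
  lcoset x H = lcoset y H <-> H (x^-1 * y).
Proof.
move=> sH; split=> [e|Hxy].
  by apply/lcosetE; rewrite e; exact: lcoset_refl.
apply/seteqP; split; apply: lcoset_trans => //; apply/lcosetE => //.
exact: subgroup_divC.
Qed.

End Cosets.

(** This property is shared by [G], [Aut U] and [CommA G]; it lets the Baire argument run with
    cosets as its basic open sets. *)
Definition nonarchimedean (T : topologicalGroupType) : Prop :=
  forall W : set T, nbhs 1 W -> exists H : openSubgroup T, H `<=` W.

Section TopologicalGroups.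
Context {T : topologicalGroupType}.
Implicit Types (H K : openSubgroup T) (x y : T).

Lemma mulg_continuous2 (S : topologicalType) (f g : S -> T) :
  continuous f -> continuous g -> continuous (fun s => f s * g s).
Proof.
move=> cf cg s; apply: (@continuous_comp _ _ _ (fun s => (f s, g s))
  (fun xy : T * T => xy.1 * xy.2)); last exact: mulg_continuous.
exact: cvg_pair (cf s) (cg s).
Qed.

Lemma mulgl_continuous x : continuous (fun y => x * y).
Proof.
by apply: mulg_continuous2 => y; [exact: cvg_cst|exact: cvg_id].
Qed.

Lemma nbhs_mull x y (A : set T) : nbhs y [set z | A (x * z)] <-> nbhs (x * y) A.
Proof.
split=> [nA|/mulgl_continuous//].
have : nbhs (x * y) ((fun z => x^-1 * z) @^-1` [set z | A (x * z)]).
  by apply: mulgl_continuous; rewrite mulKg.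
by apply: filterS => z /=; rewrite mulVKg.
Qed.

Lemma open_subgroup (A : set T) : is_subgroup A -> nbhs 1 A -> open A.
Proof.
move=> sA nA; rewrite openE => x Ax; rewrite /interior -[x]mulg1.
by apply/nbhs_mull; apply: filterS nA => z Az /=; exact: subgroupM.
Qed.

Lemma nbhs_os H : nbhs 1 (os_set H).
Proof. by apply: open_nbhs_nbhs; split; [exact: os_open|exact: os1]. Qed.

Lemma nbhs_lcoset x H : nbhs x (lcoset x H).
Proof.
rewrite -{1}[x]mulg1; apply/nbhs_mull; apply: filterS (nbhs_os H) => z Hz.
by exists z.
Qed.

Lemma open_lcoset x H : open (lcoset x H).
Proof.
rewrite openE => y xy; rewrite /interior; apply: filterS (nbhs_lcoset y H).
exact/lcoset_trans/xy/os_subgroup.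
Qed.

Lemma closed_lcoset x H : closed (lcoset x H).
Proof.
move=> y /(_ _ (nbhs_lcoset y H)) [z [xz yz]].
apply: (lcoset_trans (os_subgroup H) xz); apply/lcosetE.
by apply: subgroup_divC; [exact: os_subgroup|exact/lcosetE].
Qed.

Lemma os_closed H : closed (os_set H).
Proof.
have -> : os_set H = lcoset 1 H; last exact: closed_lcoset.
by apply/seteqP; split=> z; rewrite lcosetE invg1 mul1g.
Qed.

(** The open cosets [x H] with [x] in [Z] cover [Z], and two cosets that meet are equal, so a finite
    subcover already lists them all. *)
Lemma finite_lcosets (Z : set T) H : compact Z ->
  finite_set [set lcoset x H | x in Z].
Proof.
pose pT : ptopologicalType := HB.pack T (isPointed.Build T 1).
move=> cZ; have : @cover_compact pT Z by rewrite -compact_cover.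
case/(_ T Z (fun x => lcoset x H)).
- by move=> x _; exact: open_lcoset.
- by move=> x Zx; exists x => //; exact/lcoset_refl/os_subgroup.
move=> D _ ZD; have fD : finite_set [set lcoset x H | x in [set` D]].
  exact/finite_image/finite_fset.
apply: sub_finite_set fD => _ [x /ZD[y Dy /lcosetE xy] <-]; exists y => //.
by apply/lcoset_eqP => //; exact: os_subgroup.
Qed.

Lemma compactM (A B : set T) : compact A -> compact B ->
  compact [set x * y | x in A & y in B].
Proof.
move=> cA cB.
have -> : [set x * y | x in A & y in B] =
    (fun xy : T * T => xy.1 * xy.2) @` (A `*` B).
  apply/seteqP; split; first by move=> _ [x Ax [y By <-]]; exists (x, y).
  by move=> _ [[x y] [Ax By] <-]; exists x => //; exists y.
apply: continuous_compact; last exact: compact_setX.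
exact/continuous_subspaceT/mulg_continuous.
Qed.

Lemma compact_mull x (A : set T) : compact A -> compact ([set x * y | y in A]).
Proof.
by move=> cA; apply: continuous_compact cA; exact/continuous_subspaceT/mulgl_continuous.
Qed.

Hypothesis naT : nonarchimedean T.

Lemma nbhs_nonarch x (W : set T) : nbhs x W ->
  exists H : openSubgroup T, lcoset x H `<=` W.
Proof.
rewrite -{1}[x]mulg1 => /(nbhs_mull x 1 W).2 /naT[H HW]; exists H => _ [h Hh <-].
exact: HW.
Qed.

(** If no member of [S] contained a coset, one could choose a decreasing sequence of cosets in [P],
    the [n]-th choice avoiding the member of [S] coded by [n]. Cosets are closed, so compactness of
    [P] yields a common point, which no member of [S] contains. *)
Lemma baire_nonarch (P : set T) (S : set (set T)) :
  compact P -> open P -> P !=set0 -> countable S ->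
  (forall X, S X -> closed X) -> P `<=` \bigcup_(X in S) X ->
  exists X x (H : openSubgroup T), S X /\ lcoset x H `<=` X.
Proof.
move=> cP oP [p Pp] /countable_injP[f finj] cS PS; apply: contrapT => noint.
(* The coset shrinks around a point outside the closed set coded by [n]; it is kept unchanged when
   [n] codes no set. *)
have step n (q : {q : T * openSubgroup T | lcoset q.1 q.2 `<=` P}) :
    exists r : {q : T * openSubgroup T | lcoset q.1 q.2 `<=` P},
    lcoset (sval r).1 (sval r).2 `<=` lcoset (sval q).1 (sval q).2 /\
    forall X, S X -> f X = n -> lcoset (sval r).1 (sval r).2 `&` X = set0.
  case: q => -[x H] /= xP.
  have [[X SX fX]|nX] := pselect (exists2 X, S X & f X = n); last first.
    by exists (exist _ (x, H) xP); split=> // X SX fX; case: nX; exists X.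
  have [y xy nXy] : exists2 y, lcoset x H y & ~ X y.
    apply: contrapT => nex; apply: noint; exists X, x, H; split=> // y xy.
    by apply: contrapT => nXy; apply: nex; exists y.
  have [K KX] : exists K : openSubgroup T, lcoset y K `<=` ~` X.
    have nX : nbhs y (~` X).
      by apply: open_nbhs_nbhs; split=> //; apply: closed_openC; exact: cS.
    exact: nbhs_nonarch nX.
  have yx : lcoset y (osI H K) `<=` lcoset x H.
    apply: subset_trans (lcoset_trans (os_subgroup H) xy).
    by move=> _ [k [Hk _] <-]; exists k.
  exists (exist _ (y, osI H K) (subset_trans yx xP)); split=> //= Y SY fY.
  rewrite (_ : Y = X).
    by rewrite -subset0 => z [[k [Hk Kk] <-]]; apply: KX; exists k.
  by apply: finj; rewrite ?inE// fY.
have [H0 H0P] := nbhs_nonarch (open_nbhs_nbhs (conj oP Pp)).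
pose next n q := projT1 (cid (step n q)).
pose q := fix q n := if n is m.+1 then next m (q m) else
  exist (fun q : T * openSubgroup T => lcoset q.1 q.2 `<=` P) (p, H0) H0P.
pose O n := lcoset (sval (q n)).1 (sval (q n)).2.
have ON n : O n.+1 `<=` O n by have [] := projT2 (cid (step n (q n))).
have OX n X : S X -> f X = n -> O n.+1 `&` X = set0.
  by have [_] := projT2 (cid (step n (q n))); exact.
have Omon m n : (m <= n)%N -> O n `<=` O m.
  by move=> /subnKC <-; elim: (n - m)%N => [|k IH]; rewrite ?addn0// addnS;
    apply: subset_trans (ON _) _.
(* A cluster point of the filter generated by the nested cosets lies in each of them, since they are
   closed. *)
have PF : ProperFilter (filter_from [set: nat] O).
  apply: filter_from_proper; last first.
    by move=> n _; eexists; exact/lcoset_refl/os_subgroup.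
  apply: filter_from_filter; first by exists 0.
  move=> m n _ _; exists (maxn m n) => // x Ox.
  by split; apply: Omon Ox; rewrite ?leq_maxl ?leq_maxr.
have FP : filter_from [set: nat] O P by exists 0 => //; exact: H0P.
have [x [Px clx]] := cP _ PF FP.
have Ox n : O n x.
  apply: closed_lcoset => B nB.
  by apply: (clx (O n) B) => //; exists n.
have [X SX Xx] := PS _ Px.
by have := OX _ _ SX erefl; rewrite -subset0 => /(_ x); apply.
Qed.

(** By Baire some coset [x Q] contains a coset [y H] with [H] open; translating by the inverse of
    [y] gives that [Q] contains [H]. *)
Lemma open_countable_index (P Q : set T) : compact P -> open P -> P !=set0 ->
  closed Q -> is_subgroup Q -> countable [set lcoset x Q | x in P] -> open Q.
Proof.
move=> cP oP P0 cQ sQ cI.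
have := @baire_nonarch P _ cP oP P0 cI; case.
- move=> _ [x Px <-].
  have -> : lcoset x Q = (fun y => x^-1 * y) @^-1` Q.
    by apply/seteqP; split=> y /lcosetE.
  by apply: preimage_closed => // y _; exact: mulgl_continuous.
- by move=> x Px; exists (lcoset x Q); [exists x|exact: lcoset_refl].
move=> _ [y [H [[x _ <-] yx]]]; apply: open_subgroup => //.
have /lcosetE xy : lcoset x Q y by apply/yx/lcoset_refl/os_subgroup.
apply: filterS (nbhs_os H) => h Hh.
have /lcosetE : lcoset x Q (y * h) by apply: yx; exists h.
by rewrite mulgA => /(subgroupM sQ (subgroupV sQ xy)); rewrite mulKg.
Qed.

End TopologicalGroups.

(** * The group Aut(U) *)

Section AutGroup.
Context {G : topologicalGroupType} (U : openSubgroup G).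
Implicit Types (a b c : Aut U) (x y : G).

(** Elements of [Aut U] are the identity outside [U], so [f] is redefined there and only its values
    on [U] survive. *)
Lemma mk_aut (f g : G -> G) : top_inverse U U f g ->
  exists a, forall x, os_set U x -> a x = f x.
Proof.
move=> [hf hg fK gK]; have [mf _ _] := hf; have [mg _ _] := hg.
pose p h x : G := if pselect (os_set U x) then h x else x.
have pE h x : os_set U x -> p h x = h x by rewrite /p; case: pselect.
have iso : top_iso U U (p f).
  exists (p g); split.
  - by apply: top_hom_eq hf => x Ux; rewrite pE.
  - by apply: top_hom_eq hg => x Ux; rewrite pE.
  - by move=> x Ux; rewrite (pE f)// pE ?fK//; exact: mf.
  - by move=> x Ux; rewrite (pE g)// pE ?gK//; exact: mg.
have out x : ~ os_set U x -> p f x = x by rewrite /p; case: pselect.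
by exists (MkAut iso out) => x Ux /=; rewrite pE.
Qed.

Lemma aut_hom a : top_hom U U a.
Proof. by case: (aut_iso a) => g []. Qed.

Lemma aut_in a x : os_set U x -> os_set U (a x).
Proof. by case: (aut_hom a) => + _ _; exact. Qed.

Lemma autDM a x y : os_set U x -> os_set U y -> a (x * y) = a x * a y.
Proof. by case: (aut_hom a) => _ + _; exact. Qed.

Lemma autDV a x : os_set U x -> a x^-1 = (a x)^-1.
Proof. exact/top_homV/aut_hom. Qed.

Lemma aut_one_subproof : exists a, forall x, os_set U x -> a x = x.
Proof. exact/mk_aut/top_inverse_id. Qed.

Lemma aut_mul_subproof a b : exists c, forall x, os_set U x -> c x = a (b x).
Proof.
have [f [ha hf aK fK]] := aut_iso a; have [g [hb hg bK gK]] := aut_iso b.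
have [[ma _ _] [mb _ _]] := (ha, hb); have [[mf _ _] [mg _ _]] := (hf, hg).
apply: (@mk_aut (a \o b) (g \o f)); split.
- by apply: (@top_hom_comp _ _ U U) => //; exact: os_open.
- by apply: (@top_hom_comp _ _ U U) => //; exact: os_open.
- by move=> x Ux /=; rewrite aK ?bK//; exact: mb.
- by move=> x Ux /=; rewrite gK ?fK//; exact: mf.
Qed.

Lemma aut_inv_subproof a : exists b,
  (forall x, os_set U x -> b (a x) = x) /\ (forall x, os_set U x -> a (b x) = x).
Proof.
have [f af] := aut_iso a; have [[ma _ _] [mf _ _] aK fK] := af.
have [b bf] := mk_aut (top_inverse_sym af); exists b; split=> x Ux.
  by rewrite bf ?aK//; exact: ma.
by rewrite bf ?fK.
Qed.

Definition aut_one := projT1 (cid aut_one_subproof).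
Definition aut_mul a b := projT1 (cid (aut_mul_subproof a b)).
Definition aut_inv a := projT1 (cid (aut_inv_subproof a)).

Lemma aut_oneE x : os_set U x -> aut_one x = x.
Proof. exact: projT2 (cid aut_one_subproof) x. Qed.

Lemma aut_mulE a b x : os_set U x -> aut_mul a b x = a (b x).
Proof. exact: projT2 (cid (aut_mul_subproof a b)) x. Qed.

Lemma aut_invK a x : os_set U x -> aut_inv a (a x) = x.
Proof. by case: (projT2 (cid (aut_inv_subproof a))) => + _; exact. Qed.

Lemma aut_invVK a x : os_set U x -> a (aut_inv a x) = x.
Proof. by case: (projT2 (cid (aut_inv_subproof a))) => _; exact. Qed.

Lemma aut_mulA : associative aut_mul.
Proof.
move=> a b c; apply: autP => x Ux.
by rewrite !aut_mulE//; exact: aut_in.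
Qed.

Lemma aut_mul1 : left_id aut_one aut_mul.
Proof.
by move=> a; apply: autP => x Ux; rewrite aut_mulE ?aut_oneE//; exact: aut_in.
Qed.

Lemma aut_mulr1 : right_id aut_one aut_mul.
Proof. by move=> a; apply: autP => x Ux; rewrite aut_mulE ?aut_oneE. Qed.

Lemma aut_mulV : left_inverse aut_one aut_inv aut_mul.
Proof.
by move=> a; apply: autP => x Ux; rewrite aut_mulE ?aut_oneE// aut_invK.
Qed.

Lemma aut_mulrV : right_inverse aut_one aut_inv aut_mul.
Proof.
by move=> a; apply: autP => x Ux; rewrite aut_mulE ?aut_oneE// aut_invVK.
Qed.

HB.instance Definition _ := isGroup.Build (Aut U)
  aut_mulA aut_mul1 aut_mulr1 aut_mulV aut_mulrV.

Lemma aut1E x : os_set U x -> (1 : Aut U) x = x.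
Proof. exact: aut_oneE. Qed.

Lemma autME a b x : os_set U x -> (a * b) x = a (b x).
Proof. exact: aut_mulE. Qed.

Lemma autK a x : os_set U x -> a^-1 (a x) = x.
Proof. exact: aut_invK. Qed.

Lemma autVK a x : os_set U x -> a (a^-1 x) = x.
Proof. exact: aut_invVK. Qed.

Lemma Aut_stabP (V : set G) a : V `<=` U ->
  Aut_stab V a <-> set_fun V V a /\ set_fun V V (a^-1)%g.
Proof.
move=> VU; split=> [aV|[aV a'V]].
  split=> x Vx; first by rewrite -aV; exists x.
  by move: Vx; rewrite -{1}aV => -[y Vy <-] /=; rewrite autK//; exact: VU.
apply/seteqP; split=> [_ [x Vx <-]|x Vx]; first exact: aV.
by exists (a^-1 x); [exact: a'V|rewrite autVK//; exact: VU].
Qed.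

Lemma Aut_stab_subgroup (V : set G) : V `<=` U -> is_subgroup (@Aut_stab G U V).
Proof.
move=> VU; apply/is_subgroupP; split.
  by apply/(Aut_stabP _ VU); split=> x Vx; rewrite /= ?invg1 aut1E//; exact: (VU _ Vx).
move=> a b /(Aut_stabP _ VU)[aV a'V] /(Aut_stabP _ VU)[bV b'V].
apply/(Aut_stabP _ VU); rewrite invgM invgK.
by split=> x Vx; rewrite /= autME; [apply: aV; exact: b'V|exact: VU
  |apply: bV; exact: a'V|exact: VU].
Qed.

Lemma TAut_subgroup : is_subgroup (@TAut G U).
Proof.
apply/is_subgroupP; split.
  by exists U; split=> // x Ux; rewrite aut1E.
move=> a b [W [WU aW]] [W' [W'U bW]]; exists (osI W W').
split=> x [Wx W'x]; first exact: WU.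
have Ux := WU _ Wx.
by rewrite autME// -{1}[x]bW// autK ?aW.
Qed.

End AutGroup.

(** * The topology of Aut(U) *)

Lemma hausdorff_subgroups (T : topologicalGroupType) :
  (forall x : T, x <> 1 -> exists H : openSubgroup T, ~ os_set H x) ->
  hausdorff_space T.
Proof.
move=> sepT p q clpq; apply: contrapT => npq.
have [|H nH] := sepT (p^-1 * q).
  by move=> e; apply: npq; rewrite -[q](mulVKg p) e mulg1.
have [z [/lcosetE pz /lcosetE qz]] := clpq _ _ (nbhs_lcoset p H) (nbhs_lcoset q H).
apply: nH; have := osM pz (osV qz).
by rewrite invgM invgK mulgA mulgK.
Qed.

Section AutTop.
Context {G : topologicalGroupType} (Gprof : profinite G) (Ghccb : hccb G).
Implicit Types (U C O : openSubgroup G).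

Lemma char_open_in U W : nbhs (1 : G) W -> exists2 C, char_open U C & C `<=` W.
Proof.
by have [B [_ BU BW]] := Ghccb U; move=> /BW[C /BU charC CW]; exists C.
Qed.

Lemma hccb_nonarchimedean : nonarchimedean G.
Proof. by move=> W /(char_open_in (osT G))[C _ CW]; exists C. Qed.

Lemma char_eq U (x y : G) :
  (forall C, char_open U C -> os_set C (x^-1 * y)) -> x = y.
Proof.
move=> Cxy; apply: contrapT => nxy; have [_ hG _] := Gprof.
have : nbhs (1 : G) (~` [set x^-1 * y]).
  apply: open_nbhs_nbhs; split; last first.
    by move=> /= e; apply: nxy; rewrite -[y](mulVKg x) -e mulg1.
  by apply: closed_openC; apply: accessible_closed_set1; exact: hausdorff_accessible.
by move=> /(char_open_in U)[C /Cxy Cxy' CW]; exact: CW Cxy' erefl.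
Qed.

Lemma compact_os U : compact (os_set U).
Proof.
have [cG _ _] := Gprof.
exact: subclosed_compact (@os_closed G U) cG (@subsetT _ _).
Qed.

(** Multiplicativity reduces continuity to the point [1], where open subgroups form a base. *)
Lemma top_homI U (B : set G) (f : G -> G) : set_fun U B f ->
  (forall x y, os_set U x -> os_set U y -> f (x * y) = f x * f y) ->
  (forall O, exists O', forall x, os_set U x -> os_set O' x -> os_set O (f x)) ->
  top_hom U B f.
Proof.
move=> mf fM fO; split=> //; apply/subspace_continuousP => x Ux W nW.
have [O OW] := nbhs_nonarch hccb_nonarchimedean nW.
have [O' O'O] := fO O; rewrite /fmap /= /within /=.
apply: filterS (nbhs_lcoset x (osI O' U)) => y [h [O'h Uh] <-] _.
by apply: OW; rewrite /from_subspace fM//; exists (f h) => //; exact: O'O.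
Qed.

Lemma char_openT U : char_open U U.
Proof.
split=> // a; apply/(Aut_stabP _ (@subset_refl _ _)).
by split=> x; exact: aut_in.
Qed.

Lemma char_openP U C (a : Aut U) x : char_open U C -> os_set U x ->
  os_set C (a x) <-> os_set C x.
Proof.
move=> [CU aC] Ux; have /(Aut_stabP _ CU)[aCC a'CC] := aC a.
by split=> [Cax|/aCC//]; rewrite -(autK a Ux); exact: a'CC.
Qed.

Lemma inner_aut U u : os_set U u ->
  exists a : Aut U, forall x, os_set U x -> a x = u * x * u^-1.
Proof.
move=> Uu; pose c v : G -> G := inner v.
have hom v : os_set U v -> top_hom U U (c v).
  move=> Uv; apply: top_hom_restr (va_hom (inner v)) => // x Ux.
  by apply: osM (osV Uv); exact: osM.
apply: (@mk_aut _ _ (c u) (c u^-1)); split.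
- exact: hom.
- exact/hom/osV.
- by move=> x _; rewrite /c /= invgK !mulgA mulVg mul1g mulgVK.
- by move=> x _; rewrite /c /= invgK !mulgA mulgV mul1g mulgK.
Qed.

(** Conjugation by an element of [U] is an automorphism of [U], hence preserves [C]. *)
Lemma char_normal U C u x : char_open U C -> os_set U u -> os_set C x ->
  os_set C (u * x * u^-1).
Proof.
move=> charC Uu Cx; have [CU _] := charC; have [a au] := inner_aut Uu.
by rewrite -au; [apply/(char_openP _ charC)|]; try exact: CU.
Qed.

Section Topology.
Context (U : openSubgroup G).

Lemma aut_ball_sub (a : Aut U) (O O' : set G) : O `<=` O' ->
  aut_ball a O `<=` aut_ball a O'.
Proof. by move=> OO' b ab g /ab /OO'. Qed.

Lemma nbhs_aut (a : Aut U) (W : set (Aut U)) :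
  nbhs a W <-> exists2 C, char_open U C & aut_ball a C `<=` W.
Proof.
split=> [[O OU OW]|[C [CU _] CW]]; last by exists C.
have [C charC CO] := char_open_in U (nbhs_os O); exists C => //.
exact: subset_trans (aut_ball_sub CO) OW.
Qed.

Lemma Aut_mulg_continuous : continuous (fun ab : Aut U * Aut U => ab.1 * ab.2).
Proof.
move=> [a b] W /nbhs_aut[C charC CW] /=; have [CU _] := charC.
exists (aut_ball a C, aut_ball b C).
  by split; apply/nbhs_aut; exists C.
move=> [a' b'] [/= aa' bb']; apply: CW => g Ug; rewrite !autME//.
have Ubg := aut_in b Ug; have Cg := bb' g Ug.
(* [b' g] differs from [b g] by a right factor in [C], and [a'] keeps that factor in [C]; what
   remains is the congruence of [a] and [a'] at [b g]. *)
have -> : b' g = b g * ((b g)^-1 * b' g) by rewrite mulVKg.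
rewrite autDM//; last exact: CU.
rewrite mulgA; apply: osM; first exact: aa'.
by apply/(char_openP _ charC) => //; exact: CU.
Qed.

Lemma Aut_invg_continuous : continuous (fun a : Aut U => a^-1).
Proof.
move=> a W /nbhs_aut[C charC CW]; have [CU _] := charC.
apply/nbhs_aut; exists C => // b ab; apply: CW => g Ug.
(* The congruence of [a] and [b] at [b^-1 g], pulled back by [a^-1], compares [a^-1] and [b^-1] at
   [g]. *)
have Uh := aut_in b^-1 Ug; have Ch := ab _ Uh; rewrite autVK// in Ch.
rewrite -[X in os_set C X]invgK; apply: osV; rewrite invgM invgK.
apply/(char_openP a charC).
  by apply: osM; [exact: osV|exact: aut_in].
by rewrite autDM ?autDV ?autVK//; [exact: osV|exact: aut_in].
Qed.

(** Continuity of the operations is derived from [Ghccb], so the structure is a term carrying that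
    hypothesis rather than a canonical instance. *)
Definition AutT : topologicalGroupType := HB.pack (Aut U)
  (isTopologicalGroup.Build (Aut U) Aut_mulg_continuous Aut_invg_continuous).

Lemma aut_ball1P C (a b : Aut U) : char_open U C ->
  aut_ball a C b <-> aut_ball 1 C (a^-1 * b).
Proof.
move=> charC; split=> ab g Ug; have Uag := aut_in a Ug; have Ubg := aut_in b Ug.
  rewrite aut1E// autME//; apply/(char_openP a charC).
    by apply: osM; [exact: osV|exact: aut_in].
  by rewrite autDM ?autDV ?autVK//; [exact: ab|exact: osV|exact: aut_in].
have := ab g Ug; rewrite aut1E// autME// => /(char_openP a charC).
rewrite autDM ?autDV ?autVK//; [|exact: osV|exact: aut_in]; apply.
by apply: osM; [exact: osV|exact: aut_in].
Qed.

Lemma aut_ball_subgroup C : char_open U C -> is_subgroup (@aut_ball G U 1 C).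
Proof.
move=> charC; apply/is_subgroupP; split; first exact: aut_ball_refl.
move=> a b Ca Cb; have Cb' : aut_ball b C 1.
  by move=> g /Cb/osV; rewrite invgM invgK.
move/(aut_ball1P _ _ charC) : Cb'; rewrite mulg1 => Cb'.
apply: aut_ball_trans Ca _; apply/aut_ball1P => //.
by rewrite mulKg.
Qed.

Lemma open_aut_ball C : char_open U C -> open (@aut_ball G U 1 C).
Proof.
move=> charC; apply: (@open_subgroup AutT); first exact: aut_ball_subgroup.
by apply/nbhs_aut; exists C.
Qed.

Definition os_aut_ball C (charC : char_open U C) : openSubgroup AutT :=
  @OpenSubgroup AutT _ (aut_ball_subgroup charC) (open_aut_ball charC).

Lemma Aut_nonarchimedean : nonarchimedean AutT.
Proof. by move=> W /nbhs_aut[C charC CW]; exists (os_aut_ball charC). Qed.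

Lemma Aut_hausdorff : hausdorff_space (Aut U).
Proof.
apply: (@hausdorff_subgroups AutT) => a a1.
have [g [Ug ag]] : exists g, os_set U g /\ a g <> g.
  apply: contrapT => nex; apply: a1; apply: autP => g Ug.
  by rewrite aut1E//; apply: contrapT => ag; apply: nex; exists g.
have [C [charC nC]] : exists C, char_open U C /\ ~ os_set C (g^-1 * a g).
  apply: contrapT => nex; apply: ag; apply/esym; apply: (@char_eq U) => C charC.
  by apply: contrapT => nC; apply: nex; exists C.
by exists (os_aut_ball charC) => /(_ g Ug); rewrite aut1E.
Qed.

(** * Limits of automorphisms along an ultrafilter *)

Section Limit.
Context (F : set_system (Aut U)) (FU : UltraFilter F).

(** This is convergence of [s a] to [f] along [F], uniform on [U]. The parameter [s] allows both [a]
    and its inverse to be followed along the same ultrafilter. *)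
Definition aut_limit (s : Aut U -> Aut U) (f : G -> G) : Prop :=
  forall C, char_open U C ->
  F [set a | forall x, os_set U x -> os_set C ((f x)^-1 * s a x)].

Lemma ultra_pointwise (e : Aut U -> G) : (forall a, os_set U (e a)) ->
  exists y : G, forall W, nbhs y W -> F (e @^-1` W).
Proof.
move=> eU; have PF : ProperFilter (fmap e F) by exact: fmap_proper_filter.
have [|y [_ cly]] := @compact_os U _ PF.
  by rewrite /fmap /=; apply: filterS filterT => a _; exact: eU.
exists y => W nW; have [//|FnW] := in_ultra_setVsetC (e @^-1` W) FU.
by have [z [nWz Wz]] := cly (~` W) W FnW nW.
Qed.

(** Pointwise limits exist because [U] is compact. Modulo a characteristic [C], closeness at [x]
    propagates to the whole coset [x C], and compactness of [U] then makes it uniform. *)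
Lemma aut_limit_exists s : exists f, aut_limit s f.
Proof.
have /choice[f flim] x : exists y : G, os_set U x ->
    forall W, nbhs y W -> F ((fun a => s a x) @^-1` W).
  have [Ux|//] := pselect (os_set U x); last by exists 1.
  have [y yF] := @ultra_pointwise (fun a => s a x) (fun a => aut_in _ Ux).
  by exists y.
exists f => C charC; have [CU _] := charC.
have FfC x : os_set U x -> F [set a | os_set C ((f x)^-1 * s a x)].
  move=> Ux; apply: filterS (flim x Ux _ (nbhs_lcoset (f x) C)) => a /=.
  by move=> /lcosetE.
have /compact_near_coveringP := @compact_os U.
move=> /(_ _ F (fun a x => os_set C ((f x)^-1 * s a x)) _); apply => x Ux.
exists (lcoset x C, [set a | os_set C ((f x)^-1 * s a x)]).
  by split; [exact: nbhs_lcoset|exact: FfC].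
move=> [_ a] [/= [c Cc <-] Ca] /=; have Uc := CU _ Cc; have Uxc := osM Ux Uc.
(* An auxiliary [b], close to [f] at both [x] and [x * c], shows that [f x] and [f (x * c)] agree
   modulo [C]. *)
have [b [/= b1 b2]] := filter_ex (filterI (FfC _ Ux) (FfC _ Uxc)).
have Cs (d : Aut U) : os_set C (s d c) by apply/(char_openP _ charC).
rewrite !autDM// in b2 *.
have := osM (osM b2 (osV (Cs b))) (osM (osV b1) (osM Ca (Cs a))).
by rewrite !invgM !invgK !mulgA !mulgK.
Qed.

(** Modulo each characteristic [C] the limit agrees with some automorphism [s a], so it is
    multiplicative modulo [C] and maps [C] into [C]. Such subgroups form a base at [1]. *)
Lemma aut_limit_hom s f : aut_limit s f -> top_hom U U f.
Proof.
move=> flim; have mf : set_fun U U f.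
  move=> x Ux; have [a /(_ _ Ux)] := filter_ex (flim _ (char_openT U)).
  by move/osV/(osM (aut_in (s a) Ux)); rewrite invgM invgK mulVKg.
apply: top_homI => // [x y Ux Uy|O].
  apply: (@char_eq U) => C charC; have [CU _] := charC.
  have [a fa] := filter_ex (flim _ charC).
  have Uxy := osM Ux Uy.
  have := osM (fa _ Uxy) (osV (fa _ Uy)); rewrite autDM//.
  move/osM/(_ (char_normal charC (osV (mf _ Uy)) (osV (fa _ Ux)))).
  by rewrite !invgM !invgK !mulgA !mulgK.
have [C charC CO] := char_open_in U (nbhs_os O); exists C => x Ux Cx.
have [a /(_ _ Ux) fa] := filter_ex (flim _ charC).
apply: CO; rewrite -[f x]invgK; apply: osV.
have Ca : os_set C (s a x) by apply/(char_openP _ charC).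
by have := osM fa (osV Ca); rewrite mulgK.
Qed.

(** For each [C] one index [a] serves both limits: modulo [C], [g (f x)] is [(s a)^-1 (f x)], which
    is [x]. *)
Lemma aut_limitK s t f g : (forall a, t a = (s a)^-1) ->
  aut_limit s f -> aut_limit t g -> forall x, os_set U x -> g (f x) = x.
Proof.
move=> ts flim glim x Ux; have [mf _ _] := aut_limit_hom flim.
apply: (@char_eq U) => C charC; have [CU _] := charC.
have [a [/(_ _ Ux) fa ga]] := filter_ex (filterI (flim _ charC) (glim _ charC)).
have := ga _ (mf _ Ux); rewrite ts => {}ga.
have : os_set C ((s a)^-1 ((f x)^-1 * s a x)) by apply/(char_openP _ charC); try exact: CU.
rewrite autDM ?autDV ?autK//; try exact: mf; try exact: aut_in.
  by move/(osM ga); rewrite mulgA mulgK.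
exact/osV/mf.
Qed.

End Limit.

(** Along an ultrafilter the automorphisms and their inverses have uniform limits, which are inverse
    to each other; uniform convergence is convergence in [Aut U]. *)
Lemma Aut_compact : compact [set: Aut U].
Proof.
rewrite compact_ultra => F FU _.
have [f flim] := aut_limit_exists FU id.
have [g glim] := aut_limit_exists FU (fun a => a^-1).
have [|b bf] := @mk_aut _ U f g.
  split.
  - exact: aut_limit_hom flim.
  - exact: aut_limit_hom glim.
  - exact: aut_limitK flim glim.
  - by apply: aut_limitK glim flim => a; rewrite invgK.
exists b; split=> //= W /nbhs_aut[C charC CW].
by apply: filterS (flim _ charC) => a fa; apply: CW => x Ux; rewrite bf//; exact: fa.
Qed.

End Topology.
End AutTop.

(** * From Aut2 to local compactness *)

Lemma countable_finite_unions T (Z : set (set T)) : countable Z ->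
  countable [set \bigcup_(X in A) X | A in [set A | A `<=` Z /\ finite_set A]].
Proof. by move=> cZ; exact/countable_image/countable_finite_subset. Qed.

(** * The homomorphism from automorphisms to the commensurator *)

Section Rho.
Context {G : topologicalGroupType}.
Implicit Types (U V C O : openSubgroup G).

Lemma rhoP U V (a : Aut U) (b : Aut V) :
  rho a = rho b <-> exists W : openSubgroup G,
    [/\ W `<=` U, W `<=` V & forall x, os_set W x -> a x = b x].
Proof. exact: comm_classP. Qed.

Lemma rhoM U (a b : Aut U) : rho (a * b) = rho a * rho b.
Proof.
rewrite [RHS]comm_mulE; apply/comm_classP; exists U; split=> //=.
  by move=> x Ux; split=> //; exact: aut_in.
by move=> x Ux; rewrite autME.
Qed.

Lemma rho1 U : rho (1 : Aut U) = 1.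
Proof. by apply/rho_eq1; exists U; split=> // x Ux; rewrite aut1E. Qed.

Lemma rhoV U (a : Aut U) : rho a^-1 = (rho a)^-1.
Proof. by apply: (@mulgI _ (rho a)); rewrite -rhoM !mulgV rho1. Qed.

Lemma preim_rho_subgroup U (K : set (Comm G)) :
  is_subgroup K -> is_subgroup ((@rho G U) @^-1` K).
Proof.
move=> sK; apply/is_subgroupP; split; first by rewrite /= rho1; exact: subgroup1.
by move=> a b Ka Kb; rewrite /= rhoM rhoV; apply: subgroupM => //; exact: subgroupV.
Qed.

Lemma rho_image_subgroup U (D : set (Aut U)) :
  is_subgroup D -> is_subgroup ((@rho G U) @` D).
Proof.
move=> sD; apply/is_subgroupP; split; first by exists 1; [exact: subgroup1|exact: rho1].
move=> _ _ [a Da <-] [b Db <-]; exists (a / b); last by rewrite rhoM rhoV.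
by apply: subgroupM => //; exact: subgroupV.
Qed.

Lemma rho_lcoset U (a : Aut U) (D : set (Aut U)) :
  (@rho G U) @` lcoset a D = lcoset (rho a) ((@rho G U) @` D).
Proof.
apply/seteqP; split; first by move=> _ [_ [d Dd <-] <-]; exists (rho d); [exists d|rewrite rhoM].
by move=> _ [_ [d Dd <-] <-]; exists (a * d); [exists d|rewrite rhoM].
Qed.

Lemma uAut_subgroup U : is_subgroup (@uAut G U).
Proof. exact/rho_image_subgroup/subgroupT. Qed.

Lemma aut_restr U V (a : Aut U) : V `<=` U -> Aut_stab V a ->
  exists b : Aut V, forall x, os_set V x -> b x = a x.
Proof.
move=> VU aV; have [aVV a'VV] := (Aut_stabP _ VU).1 aV.
apply: (@mk_aut _ _ a (a^-1)%g); split.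
- exact: top_hom_restr (aut_hom a).
- exact: top_hom_restr (aut_hom a^-1).
- by move=> x Vx; rewrite autK//; exact: VU.
- by move=> x Vx; rewrite autVK//; exact: VU.
Qed.

Lemma rho_restr U V (a : Aut U) (b : Aut V) : V `<=` U ->
  (forall x, os_set V x -> b x = a x) -> rho b = rho a.
Proof. by move=> VU ba; apply/rhoP; exists V; split. Qed.

Lemma uAut_stab_sub U V : V `<=` U -> uAut_stab U V `<=` uAut V.
Proof.
move=> VU _ [a aV <-]; have [b ba] := aut_restr VU aV.
by exists b => //; exact: rho_restr ba.
Qed.

End Rho.

(** * The Aut-topology under Aut-stability *)

Section CommTop.
Context {G : topologicalGroupType} (Gprof : profinite G) (Ghccb : hccb G).
Implicit Types (U V C O : openSubgroup G).

Definition CommT : topologicalGroupType := HB.pack (CommA G)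
  (isTopologicalGroup.Build (CommA G) (commA_mul Ghccb) (commA_inv Ghccb)).

Lemma nbhs1_commA (W : set (CommA G)) :
  nbhs (1 : CommA G) W <-> exists2 H, @aut_base G H & H `<=` W.
Proof.
have e H : lcoset (1 : Comm G) H = H.
  by apply/seteqP; split=> z; rewrite lcosetE invg1 mul1g.
by split=> -[H bH HW]; exists H => //; move: HW; rewrite e.
Qed.

Lemma aut_base_open (H : set (CommA G)) : @aut_base G H -> open H.
Proof.
move=> bH; apply: (@open_subgroup CommT); first by case: bH.
by apply/nbhs1_commA; exists H.
Qed.

Definition os_aut_base (H : set (CommA G)) (bH : @aut_base G H) :
  openSubgroup CommT := @OpenSubgroup CommT _ bH.1 (aut_base_open bH).

Lemma CommA_nonarchimedean : nonarchimedean CommT.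
Proof. by move=> W /nbhs1_commA[H bH HW]; exists (os_aut_base bH). Qed.

Lemma rho_continuous U : continuous (fun a : Aut U => rho a : CommA G).
Proof.
move=> a W [H [sH oH] HW] /=.
suff : nbhs (a : AutT Ghccb U) ((@rho G U) @^-1` W) by [].
rewrite -[a]mulg1; apply/nbhs_mull.
have : nbhs (1 : Aut U) ((@rho G U) @^-1` H).
  by apply: open_nbhs_nbhs; split=> //=; rewrite rho1; exact: subgroup1.
by apply: filterS => b Hb; apply: HW; exists (rho b); rewrite //= rhoM.
Qed.

Lemma compact_rho U (Z : set (Aut U)) : compact Z ->
  compact ((fun a : Aut U => rho a : CommA G) @` Z).
Proof.
by move=> cZ; apply: continuous_compact cZ; exact/continuous_subspaceT/rho_continuous.
Qed.

Lemma compact_uAut U : compact (uAut U : set (CommA G)).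
Proof. exact/compact_rho/Aut_compact. Qed.

(** Any [O] has a characteristic open subgroup [C] inside [U]. Restriction from [Aut O] to [Aut C]
    preserves classes and congruences, so small subgroups suffice to test openness. *)
Lemma aut_base_local U (K : set (Comm G)) : is_subgroup K ->
  (forall C, C `<=` U -> nbhs (1 : Aut C) ((@rho G C) @^-1` K)) -> aut_base K.
Proof.
move=> sK nK; split=> // O; have [C [CO charC] CU] := char_open_in Ghccb O (nbhs_os U).
apply: (@open_subgroup (AutT Ghccb O)); first exact: preim_rho_subgroup.
have [N /= NC NK] := nK C CU; exists N => /=; first exact: subset_trans CO.
move=> b b1; have [c cb] := aut_restr CO (charC b).
rewrite /= -(rho_restr CO cb); apply: NK => x Cx; rewrite aut1E// cb//.
by have := b1 _ (CO _ Cx); rewrite aut1E//; exact: CO.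
Qed.

(** An automorphism congruent to [1] modulo some [N] inside [V] maps [V] into [V]; so does its
    inverse, since the congruence ball is a subgroup. *)
Lemma Aut_stab_open U V : V `<=` U -> open (@Aut_stab G U V).
Proof.
move=> VU; apply: (@open_subgroup (AutT Ghccb U)).
  exact: Aut_stab_subgroup.
have [N charN NV] := char_open_in Ghccb U (nbhs_os V).
have key (d : Aut U) : aut_ball 1 N d -> set_fun V V d.
  move=> d1 x Vx; have Ux := VU _ Vx; have /NV := d1 _ Ux.
  by rewrite aut1E// => /(osM Vx); rewrite mulVKg.
apply/(nbhs_aut Ghccb); exists N => // d d1; apply/(Aut_stabP _ VU); split; first exact: key.
by apply: key; apply: subgroupV d1; exact: aut_ball_subgroup.
Qed.

Definition os_Aut_stab U V (VU : V `<=` U) : openSubgroup (AutT Ghccb U) :=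
  @OpenSubgroup (AutT Ghccb U) _ (Aut_stab_subgroup VU) (Aut_stab_open VU).

Lemma closed_compact_Aut U (Z : set (Aut U)) : closed Z -> compact Z.
Proof.
by move=> cZ; apply: (subclosed_compact cZ (@Aut_compact _ Gprof Ghccb U)).
Qed.

(* The preimage is [res Z * TAut C], a product of two compact sets. *)
Lemma closed_preim_rho U C (Z : set (Aut U)) : closed (@TAut G C) -> C `<=` U ->
  compact Z -> Z `<=` Aut_stab C -> closed ((@rho G C) @^-1` ((@rho G U) @` Z)).
Proof.
move=> cT CU cZ ZC.
have /choice[res resE] (a : Aut U) : exists b : Aut C, Aut_stab C a ->
    forall x, os_set C x -> b x = a x.
  have [/(aut_restr CU)[b ba]|na] := pselect (Aut_stab C a); first by exists b.
  by exists 1.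
have resrho a : Aut_stab C a -> rho (res a) = rho a.
  by move=> /resE; exact: rho_restr.
have -> : (@rho G C) @^-1` ((@rho G U) @` Z) =
    [set (x * y : AutT Ghccb C) | x in (res @` Z) & y in @TAut G C].
  apply/seteqP; split=> [b [a Za ab]|_ [_ [a Za <-] [t /rho_eq1 t1 <-]]].
    exists (res a); first by exists a.
    exists ((res a)^-1 * b); last by rewrite mulVKg.
    by apply/rho_eq1; rewrite rhoM rhoV resrho ?ab ?mulVg//; exact: ZC.
  by exists a => //; rewrite rhoM t1 mulg1 resrho//; exact: ZC.
apply: compact_closed; first exact: Aut_hausdorff.
apply: (@compactM (AutT Ghccb C)); last exact: closed_compact_Aut.
apply: continuous_compact cZ; apply/subspace_continuousP => a Za.
move=> W [N NC NW]; exists N; first exact: subset_trans CU.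
move=> b ab Zb; apply: NW => x Cx; rewrite /from_subspace !resE//; try exact: ZC.
exact/ab/CU.
Qed.

Section Stable.
Context (GAut1 : Aut1 G) (U : openSubgroup G) (Ustab : Aut_stable U).

(** By Aut-stability the classes in [Aut C] coming from automorphisms of [U] that stabilize [C] form
    an open, hence compact, subgroup [P]. Finitely many closed preimages of cosets of [D] cover [P],
    so by Baire one of them contains an open coset. *)
Lemma nbhs_rho_ball N C : char_open U N -> C `<=` U ->
  nbhs (1 : Aut C) ((@rho G C) @^-1` ((@rho G U) @` aut_ball 1 N)).
Proof.
move=> charN CU; have [_ oP] := Ustab CU; set P := _ @^-1` _ in oP.
have sP : is_subgroup P.
  exact/preim_rho_subgroup/rho_image_subgroup/Aut_stab_subgroup.
(* Intersecting with the stabilizer of [C] makes every element of [D] restrict to [C], as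
   [closed_preim_rho] demands. *)
pose D := osI (os_aut_ball Ghccb charN) (os_Aut_stab CU).
pose S := [set (@rho G C) @^-1` ((@rho G U) @` Z) |
  Z in [set lcoset a D | a in Aut_stab C]].
have [|||||| _ [y [H [[_ [a aC <-] <-] yH]]]] :=
    @baire_nonarch _ (@Aut_nonarchimedean _ Ghccb C) P S.
- apply: closed_compact_Aut.
  exact: (@os_closed _ (@OpenSubgroup (AutT Ghccb C) _ sP oP)).
- exact: oP.
- by exists 1; exact: subgroup1.
- apply/countable_image/finite_set_countable.
  apply: (@finite_lcosets (AutT Ghccb U)); apply: closed_compact_Aut.
  exact: (@os_closed _ (os_Aut_stab CU)).
- move=> _ [_ [a aC <-] <-]; apply: closed_preim_rho => //.
    by apply: closed_compact_Aut; exact: (@closed_lcoset (AutT Ghccb U)).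
  move=> _ [d [_ dC] <-]; exact: (subgroupM (Aut_stab_subgroup CU)).
- move=> b [a aC ab]; exists ((@rho G C) @^-1` ((@rho G U) @` lcoset a D)).
    by exists (lcoset a D) => //; exists a.
  by exists a => //; exact/lcoset_refl/os_subgroup.
(* The case [h = 1] supplies [d1]; dividing by it removes [y] and [a], leaving
   [rho h = rho (d1^-1 * d)]. *)
have Dy h : os_set H h -> exists2 d, @aut_ball G U 1 N d & rho y * rho h = rho a * rho d.
  move=> Hh; have [|_ [d [d1 _] <-] e] := yH (y * h); first by exists h.
  by exists d => //; rewrite -!rhoM e.
have [d1 d1N e1] := Dy 1 (os1 _).
apply: filterS (nbhs_os H) => h /Dy[d dN e].
exists (d1^-1 * d).
  have sN := aut_ball_subgroup charN.
  exact: subgroupM sN (subgroupV sN d1N) dN.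
move: e1 e; rewrite rho1 mulg1 rhoM rhoV => -> /=.
by rewrite -mulgA => /mulgI <-; rewrite mulKg.
Qed.

Lemma aut_base_rho_ball N : char_open U N ->
  aut_base ((@rho G U) @` aut_ball 1 N).
Proof.
move=> charN; apply: (@aut_base_local U); last by move=> C; exact: nbhs_rho_ball.
exact/rho_image_subgroup/aut_ball_subgroup.
Qed.

Lemma aut_base_uAut : aut_base (uAut U).
Proof.
have := aut_base_rho_ball (char_openT U); congr aut_base; congr image.
apply/seteqP; split=> // a _ x Ux; rewrite aut1E//.
by apply: osM; [exact: osV|exact: aut_in].
Qed.

(** A class outside [uAut U] is separated from [1] by that open subgroup. A nontrivial class [rho a]
    has [a] outside the closed [TAut U], so a whole ball around [a] misses [TAut U], and the image
    of the corresponding ball around [1] omits [rho a]. *)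
Lemma CommA_hausdorff : hausdorff_space (CommA G).
Proof.
apply: (@hausdorff_subgroups CommT) => c c1.
have [[a _ ac]|nc] := pselect (uAut U c); last first.
  by exists (os_aut_base aut_base_uAut).
have nTa : ~ TAut a by move/rho_eq1; rewrite ac.
have /nbhs_aut : nbhs a (~` @TAut G U).
  by apply: open_nbhs_nbhs; split=> //; apply: closed_openC; exact: GAut1.
move=> /(_ Ghccb)[N charN aN]; exists (os_aut_base (aut_base_rho_ball charN)).
move=> [d dN dc]; have sN := aut_ball_subgroup charN.
apply: (aN (a * d^-1)).
  by apply/aut_ball1P => //; rewrite mulKg; exact: subgroupV sN dN.
by apply/rho_eq1; rewrite rhoM rhoV dc ac mulgV.
Qed.

Lemma CommA_locally_compact : locally_compact [set: CommA G].
Proof.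
move=> c _; pose H := os_aut_base aut_base_uAut.
exists (lcoset c H).
  by apply: filterS (nbhs_lcoset (c : CommT) H) => x cx _.
split; last exact: (@closed_lcoset CommT).
exact/(@compact_mull CommT)/compact_uAut.
Qed.

End Stable.
End CommTop.

(** * Sigma-compactness, and from local compactness to Aut2 *)

Section Countability.
Context {G : topologicalGroupType} (Gprof : profinite G) (Ghccb : hccb G).
Implicit Types (U V C O : openSubgroup G).

Lemma os_set_inj : injective (@os_set G).
Proof.
move=> [U sU oU] [V sV oV] /= UV; subst V.
by congr OpenSubgroup; exact: Prop_irrelevance.
Qed.

(** An open subgroup is a finite union of cosets of some member of the countable base, and each
    member has only finitely many cosets in [G]. *)
Lemma countable_openSubgroup : countable [set: openSubgroup G].
Proof.
rewrite -[X in countable X]image_id.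
apply: (@countable_image_factor _ _ _ (@os_set G)).
  by move=> U V _ _ /os_set_inj.
have [cG _ _] := Gprof; have [B [cB _ BW]] := Ghccb (osT G).
have cZ : countable (\bigcup_(C in B) [set lcoset x C | x in [set: G]]).
  by apply: bigcup_countable cB _ => C _; exact/finite_set_countable/finite_lcosets.
apply: countableW (countable_finite_unions cZ) => _ [U _ <-].
have [C BC CU] := BW _ (nbhs_os U).
exists [set lcoset x C | x in os_set U].
  split; first by move=> _ [x _ <-]; exists C => //; exists x.
  exact/finite_lcosets/compact_os.
apply/seteqP; split=> [y [_ [x Ux <-] [c /CU Uc <-]]|x Ux]; first exact: osM.
by exists (lcoset x C); [exists x|exact/lcoset_refl/os_subgroup].
Qed.

Definition comm_iso (p : openSubgroup G * openSubgroup G) : set (Comm G) :=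
  [set c | exists v : virtAut G,
    [/\ va_dom v = p.1, va_cod v = p.2 & comm_class v = c]].

(** Two isomorphisms from [p.1] onto [p.2] differ by an automorphism of [p.1], composed on the
    right. *)
Lemma comm_iso_lcoset p c : comm_iso p c -> comm_iso p = lcoset c (uAut p.1).
Proof.
move=> [v [vp1 vp2 <-]]; rewrite /comm_iso -vp1 -vp2.
have [hv hv' vK v'K] := va_invfunP v; have [mv _ _] := hv; have [mv' _ _] := hv'.
apply/seteqP; split=> [_ [w [wv1 wv2 <-]]|_ [_ [a _ <-] <-]].
  have [hw hw' wK w'K] := va_invfunP w; rewrite wv1 wv2 in hw hw' wK w'K.
  have [mw _ _] := hw; have [mw' _ _] := hw'.
  have [|a aE] := @mk_aut _ (va_dom v) (va_invfun v \o w) (va_invfun w \o v).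
    split.
    - by apply: (@top_hom_comp _ _ (va_cod v) (va_cod v)) => //; exact: os_open.
    - by apply: (@top_hom_comp _ _ (va_cod v) (va_cod v)) => //; exact: os_open.
    - by move=> x Ux /=; rewrite v'K ?wK//; exact: mw.
    - by move=> x Ux /=; rewrite w'K ?vK//; exact: mv.
  apply/lcosetE; exists a => //; apply: (@mulgI _ (comm_class v)).
  rewrite mulVKg [LHS]comm_mulE; apply/comm_classP; exists (va_dom v).
  split=> [x vx|x|x vx] /=; rewrite ?wv1//.
    by split=> //=; exact: aut_in.
  by rewrite aE//= v'K//; exact: mw.
have [b [ha hb aK bK]] := aut_iso a; have [ma _ _] := ha; have [mb _ _] := hb.
have iso : top_iso (va_dom v) (va_cod v) (v \o a).
  exists (b \o va_invfun v); split.
  - by apply: (@top_hom_comp _ _ (va_dom v) (va_dom v)) => //; exact: os_open.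
  - by apply: (@top_hom_comp _ _ (va_dom v) (va_dom v)) => //; exact: os_open.
  - by move=> x Ux /=; rewrite vK ?aK//; exact: ma.
  - by move=> x Ux /=; rewrite bK ?v'K//; exact: mv'.
exists (VirtAut iso); split=> //; rewrite [RHS]comm_mulE.
apply/comm_classP; exists (va_dom v); split=> //= x vx.
by split=> //=; exact: aut_in.
Qed.

Lemma countable_comm_iso : countable (comm_iso @` setT).
Proof.
apply: countable_image; rewrite -setXTT.
by apply: countableX; exact: countable_openSubgroup.
Qed.

Lemma comm_iso_cover (c : Comm G) : exists p, comm_iso p c.
Proof.
by exists (va_dom (repr c), va_cod (repr c)), (repr c); rewrite comm_classK.
Qed.

Lemma compact_comm_iso p : compact (comm_iso p : set (CommA G)).
Proof.
have [[c pc]|np] := pselect (exists c, comm_iso p c); last first.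
  rewrite (_ : comm_iso p = set0); first exact: compact0.
  by rewrite -subset0 => c pc; apply: np; exists c.
rewrite (comm_iso_lcoset pc).
by apply: (@compact_mull (CommT Ghccb)); exact: compact_uAut.
Qed.

Lemma CommA_sigma_compact : sigma_compact (CommA G).
Proof.
have /countable_injP[f finj] := countable_comm_iso.
(* Since [f] is injective on these sets, [F n] is either empty or the single compact set coded by
   [n]. *)
pose F n : set (CommA G) := \bigcup_(X in [set X | (comm_iso @` setT) X /\ f X = n]) X.
exists F; split=> [n|].
  have [[_ [[p _ <-] fp]]|nX] :=
      pselect (exists X, (comm_iso @` setT) X /\ f X = n); last first.
    rewrite (_ : F n = set0); first exact: compact0.
    by rewrite -subset0 => c [X SX _]; apply: nX; exists X.
  rewrite (_ : F n = comm_iso p); first exact: compact_comm_iso.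
  apply/seteqP; split=> [c [Y [SY fY] Yc]|c pc]; last first.
    by exists (comm_iso p) => //; split=> //; exists p.
  by rewrite (_ : comm_iso p = Y)//; apply: finj; rewrite ?inE ?fY//; exists p.
apply/seteqP; split=> // c _; have [p pc] := comm_iso_cover c.
exists (f (comm_iso p)) => //; exists (comm_iso p) => //.
Qed.

(** Each of the countably many compact sets [comm_iso p] meets only finitely many cosets of the open
    subgroup [uAut U]. *)
Lemma countable_index_uAut U : aut_base (uAut U) -> countable_index setT (uAut U).
Proof.
move=> bU; have cS := countable_comm_iso.
have : countable (\bigcup_(X in comm_iso @` setT) [set lcoset c (uAut U) | c in X]).
  apply: bigcup_countable cS _ => _ [p _ <-]; apply: finite_set_countable.
  exact: (@finite_lcosets (CommT Ghccb) _ (os_aut_base Ghccb bU) (@compact_comm_iso p)).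
apply: countableW => _ [c _ <-]; have [p pc] := comm_iso_cover c.
by exists (comm_iso p); [exists p|exists c].
Qed.

(** * Consequences of the Hausdorff property and local compactness *)

Section LocallyCompact.
Context (hA : hausdorff_space (CommA G)).

Lemma Aut1_hausdorff : Aut1 G.
Proof.
move=> U.
have -> : @TAut G U = (fun a : Aut U => rho a : CommA G) @^-1` [set 1].
  by apply/seteqP; split=> a /rho_eq1.
apply: preimage_closed; last exact/accessible_closed_set1/hausdorff_accessible.
by move=> a _; exact: rho_continuous.
Qed.

(** A compact neighborhood of [1] contains a compact open subgroup, covered by the countably many
    closed sets [comm_iso p]. By Baire one of them contains a coset [c K]; being the coset of
    [uAut p.1] through [c], it forces [K] into [uAut p.1]. *)
Lemma exists_open_uAut : locally_compact [set: CommA G] ->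
  exists U, aut_base (uAut U).
Proof.
move=> /(_ 1 I)[W nW [cW _]].
have [H bH HW] : exists2 H, @aut_base G H & H `<=` W.
  by apply/nbhs1_commA; move: nW; apply: (@filterS _ (nbhs (1 : CommA G))) => c; exact.
have oH := aut_base_open Ghccb bH.
have cH : compact (H : set (CommA G)).
  apply: subclosed_compact cW HW.
  exact: (@os_closed _ (os_aut_base Ghccb bH)).
have [|||| _ [c [K [[p _ <-] cK]]]] :=
    @baire_nonarch _ (@CommA_nonarchimedean _ Ghccb) H (comm_iso @` setT) cH oH.
- by exists 1; case: bH => /subgroup1.
- exact: countable_comm_iso.
- by move=> _ [p _ <-]; apply: compact_closed => //; exact: compact_comm_iso.
- by move=> c _; have [p pc] := comm_iso_cover c; exists (comm_iso p) => //; exists p.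
have pc : comm_iso p c by apply/cK/lcoset_refl/os_subgroup.
exists p.1; split; first exact: uAut_subgroup.
have Kp : K `<=` uAut p.1.
  move=> k Kk; have : comm_iso p (c * k) by apply: cK; exists k.
  by rewrite (comm_iso_lcoset pc) => /lcosetE; rewrite mulKg.
have [B [sB oB] BK] := (nbhs1_commA _).1 (nbhs_os K).
move=> O; apply: (@open_subgroup (AutT Ghccb O)).
  exact/preim_rho_subgroup/uAut_subgroup.
have : nbhs (1 : Aut O) ((@rho G O) @^-1` B).
  by apply: open_nbhs_nbhs; split=> //=; rewrite rho1; exact: subgroup1.
by apply: filterS => a /BK/Kp.
Qed.

(** [uAut_stab U V] is compact, hence closed. It has finite index in the open compact group
    [uAut U], because the stabilizer of [V] is open in the compact group [Aut U]; so it is open, and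
    its preimage under [rho] is too. *)
Lemma Aut_stable_open U : aut_base (uAut U) -> Aut_stable U.
Proof.
move=> bU V VU; split; first exact: uAut_stab_sub.
have sV := rho_image_subgroup (Aut_stab_subgroup VU).
have cV : closed (uAut_stab U V : set (CommA G)).
  apply: compact_closed => //; apply: compact_rho => //; apply: closed_compact_Aut => //.
  exact: (@os_closed _ (os_Aut_stab Ghccb VU)).
suff oV : open (uAut_stab U V : set (CommA G)).
  by apply: open_comp oV => a _; exact: rho_continuous.
apply: (@open_countable_index _ (@CommA_nonarchimedean _ Ghccb) (uAut U)) => //.
- exact: compact_uAut.
- exact: aut_base_open bU.
- by exists 1; exists 1 => //; exact: rho1.
have fV := @finite_lcosets _ _ (os_Aut_stab Ghccb VU) (@Aut_compact _ Gprof Ghccb U).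
apply: countableW (countable_image (fun Z => (@rho G U) @` Z) (finite_set_countable fV)).
move=> _ [_ [a _ <-] <-]; exists (lcoset a (Aut_stab V)); first by exists a.
exact: rho_lcoset.
Qed.

End LocallyCompact.
End Countability.

(** * The index of iota(U) in ICom(U) *)

Section NormalClosure.
Context {L : groupType}.
Implicit Types (A B S : set L) (x y c : L).

Lemma subset_normal_closure S : S `<=` normal_closure S.
Proof. by move=> x Sx N [_ SN]; exact: SN. Qed.

Lemma normal_closure_normal S : is_normal (normal_closure S).
Proof.
split=> [|g x nx N NS]; last by have [[_ nN] _] := NS; exact: (nN g x (nx N NS)).
apply/is_subgroupP; split=> [N [[sN _] _]|x y nx ny N NS]; first exact: subgroup1.
have [[sN _] _] := NS.
exact: (subgroupM sN (nx N NS) (subgroupV sN (ny N NS))).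
Qed.

Context (H : set L) (sH : is_subgroup H).

Lemma countable_indexW A B : A `<=` B -> countable_index B H -> countable_index A H.
Proof. by move=> AB; apply: countableW => _ [x /AB Bx <-]; exists x. Qed.

Lemma countable_index_bigcup I (D : set I) (F : I -> set L) : countable D ->
  (forall i, D i -> countable_index (F i) H) ->
  countable_index (\bigcup_(i in D) F i) H.
Proof.
move=> cD cF; apply: countableW (bigcup_countable cD cF).
by move=> _ [x [i Di Fx] <-]; exists i => //; exists x.
Qed.

Lemma countable_index_mull x A : countable_index A H ->
  countable_index [set x * y | y in A] H.
Proof.
rewrite /countable_index image_comp.
apply: countable_image_factor => y z _ _ /= /(lcoset_eqP _ _ sH) Hyz.
by apply/lcoset_eqP => //; rewrite invgM -mulgA mulKg.
Qed.

Hypothesis commH : forall c, countable_index [set h * c | h in H] H.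

(** A product of two cosets [x H y H] is a union of cosets [x h y H], and [commH] says that the
    double coset [H y H] contains only countably many left cosets of [H]. *)
Lemma countable_indexM A B : countable_index A H -> countable_index B H ->
  countable_index [set x * y | x in A & y in B] H.
Proof.
move=> cA cB; pose F (p : set L * set L) := [set x * y | x in p.1 & y in p.2].
have := countable_index_bigcup (countableX cA cB) (F := F).
move=> cF; apply: countable_indexW (cF _).
  move=> _ [x Ax [y By <-]]; exists (lcoset x H, lcoset y H).
    by split; [exists x|exists y].
  by exists x; [exact: lcoset_refl|exists y => //; exact: lcoset_refl].
move=> [_ _] [/= [x _ <-] [y _ <-]].
apply: countableW (countable_index_mull x (commH y)).
move=> _ [_ [_ [h Hh <-] [_ [k Hk <-] <-]] <-].
exists (x * (h * y)); first by exists (h * y) => //; exists h.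
apply/lcoset_eqP => //.
have -> : x * h * (y * k) = x * (h * y) * k by rewrite !mulgA.
by rewrite mulKg.
Qed.

Fixpoint set_pow A n : set L :=
  if n is m.+1 then [set x * y | x in A & y in set_pow A m] else [set 1].

Lemma set_powD A m n x y :
  set_pow A m x -> set_pow A n y -> set_pow A (m + n) (x * y).
Proof.
elim: m x => [|m IH] x /=; first by move=> ->; rewrite mul1g.
move=> [a Aa [b Ab <-]] Ay; exists a => //; exists (b * y); last by rewrite mulgA.
exact: IH.
Qed.

Lemma set_pow1 A x : A x -> set_pow A 1 x.
Proof. by move=> Ax; exists x => //; exists 1; rewrite ?mulg1. Qed.

Lemma set_pow_normal A : (forall x, A x -> A x^-1) ->
  (forall g x, A x -> A (g * x * g^-1)) -> is_normal (\bigcup_n set_pow A n).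
Proof.
move=> AV AJ; have PV n x : set_pow A n x -> set_pow A n x^-1.
  elim: n x => [|n IH] x /=; first by move=> ->; rewrite invg1.
  move=> [a Aa [b Ab <-]]; rewrite invgM.
  change (set_pow A n.+1 (b^-1 * a^-1)); rewrite -addn1.
  by apply: set_powD; [exact: IH|exact/set_pow1/AV].
split.
  apply/is_subgroupP; split; first by exists 0.
  by move=> x y [m _ Ax] [n _ /PV Ay]; exists (m + n)%N => //; exact: set_powD.
move=> g x [n _ Ax]; exists n => //; elim: n x Ax => [|n IH] x /=.
  by move=> ->; rewrite mulg1 mulgV.
move=> [a Aa [b Ab <-]]; exists (g * a * g^-1); first exact: AJ.
by exists (g * b * g^-1); [exact: IH|rewrite !mulgA mulgVK].
Qed.

(** The normal closure consists of products of conjugates of elements of [H]. Up to inclusion, the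
    conjugate of [H] by [c] depends only on the coset [c X], so countably many conjugates suffice,
    and each meets countably many cosets of [H]. *)
Lemma countable_index_normal_closure (X : set L) : X 1 ->
  (forall x h, X x -> H h -> H (x * h * x^-1)) -> countable_index setT X ->
  countable_index (normal_closure H) H.
Proof.
move=> X1 XH cX.
(* Grouping the conjugators by cosets of [X] makes this union countable; within the coset [c X], all
   conjugates lie in the conjugate of [H] by [c]. *)
pose A := \bigcup_(Z in [set lcoset c X | c in setT])
  [set x | exists c h, [/\ Z c, H h & x = c * h * c^-1]].
have AE x : A x <-> exists c h, H h /\ x = c * h * c^-1.
  split=> [[_ [c _ <-] [d [h [_ Hh ->]]]]|[c [h [Hh ->]]]]; first by exists d, h.
  exists (lcoset c X); first by exists c.
  by exists c, h; split=> //; exists 1; rewrite ?mulg1.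
have cA : countable_index A H.
  apply: countable_index_bigcup cX _ => _ [c _ <-].
  apply: countable_indexW (countable_index_mull c (commH c^-1)).
  move=> _ [_ [h [[x Xx <-] Hh ->]]].
  exists (x * h * x^-1 * c^-1); last by rewrite invgM !mulgA.
  by exists (x * h * x^-1) => //; exact: XH.
have nA : is_normal (\bigcup_n set_pow A n).
  apply: set_pow_normal => [x /AE[c [h [Hh ->]]]|g x /AE[c [h [Hh ->]]]]; apply/AE.
    exists c, h^-1; split; first exact: subgroupV.
    by rewrite !invgM invgK !mulgA.
  by exists (g * c), h; split=> //; rewrite invgM !mulgA.
have cPA n : countable_index (set_pow A n) H.
  elim: n => [|n IH]; last exact: countable_indexM.
  by rewrite /countable_index image_set1; exact: countable1.
apply: countable_indexW (countable_index_bigcup (D := [set: nat]) _ _).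
- move=> x; apply; split; first exact: nA.
  move=> h Hh; exists 1%N => //; apply: set_pow1; apply/AE.
  by exists 1, h; split=> //; rewrite mul1g invg1 mulg1.
- exact: countableP.
- by move=> n _; exact: cPA.
Qed.

End NormalClosure.

(** * Inner classes and their commensuration *)

Section Iota.
Context {G : topologicalGroupType} (Gprof : profinite G) (Ghccb : hccb G).
Implicit Types (U V C O : openSubgroup G) (x y : G).

Lemma iotaM x y : iota_comm (x * y) = iota_comm x * iota_comm y.
Proof.
rewrite [RHS]comm_mulE; apply/comm_classP; exists (osT G).
by split=> //= z _; rewrite ?invgM ?mulgA.
Qed.

Lemma iota1 : iota_comm (1 : G) = 1.
Proof.
apply/comm_classP; exists (osT G); split=> //= z _.
by rewrite mul1g invg1 mulg1.
Qed.

Lemma iotaV x : iota_comm x^-1 = (iota_comm x)^-1.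
Proof. by apply: (@mulgI _ (iota_comm x)); rewrite -iotaM !mulgV iota1. Qed.

Lemma iota_subgroup U : is_subgroup (@iota_comm G @` U).
Proof.
apply/is_subgroupP; split; first by exists 1; [exact: os1|exact: iota1].
move=> _ _ [x Ux <-] [y Uy <-]; exists (x / y); last by rewrite iotaM iotaV.
by apply: osM => //; exact: osV.
Qed.

Lemma comm_iota (v : virtAut G) x : os_set (va_dom v) x ->
  comm_class v * iota_comm x * (comm_class v)^-1 = iota_comm (v x).
Proof.
move=> vx; apply: (@mulIg _ (comm_class v)); rewrite mulgVK.
rewrite [LHS]comm_mulE [RHS]comm_mulE; apply/comm_classP; exists (va_dom v).
have [_ vM _] := va_hom v; split=> //= y vy; last first.
  by rewrite !vM ?(top_homV (va_hom v))//; first [exact: osV|exact: osM].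
by split=> //=; apply: osM (osV vx); exact: osM.
Qed.

Lemma rho_iota U (a : Aut U) x : os_set U x ->
  rho a * iota_comm x * (rho a)^-1 = iota_comm (a x).
Proof. by move=> Ux; exact: (@comm_iota (VirtAut (aut_iso a)) x Ux). Qed.

(** For [m] in [M], [iota_comm m * c] equals [c] times the class of an element of [U]. Hence the
    coset of [iota_comm x * c] depends only on [x M], and [M] has finitely many cosets in [U]. *)
Lemma iota_commensurated U (c : Comm G) :
  countable_index [set h * c | h in @iota_comm G @` U] (@iota_comm G @` U).
Proof.
pose v := repr c; have [_ [mv' _ _] _ v'K] := va_invfunP v.
pose M := osI (os_preim U (va_invhom v)) U.
have fM := @finite_lcosets _ _ M (@compact_os _ Gprof U).
pose F (Z : set G) := [set iota_comm z * c * h | z in Z & h in @iota_comm G @` U].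
apply: countableW (countable_image F (finite_set_countable fM)).
move=> _ [_ [_ [x Ux <-] <-] <-]; exists (lcoset x M); first by exists x.
apply/seteqP; split=> [_ [_ [m [[vm Um] _] <-] [h Hh <-]]|_ [h Hh <-]]; last first.
  by exists x; [exact/lcoset_refl/os_subgroup|exists h].
apply/lcosetE; rewrite iotaM invgM !mulgA mulgVK.
apply: (subgroupM (iota_subgroup U)) => //.
exists (va_invfun v m) => //; rewrite -[c]comm_classK -/v.
by rewrite -[RHS]mulgA -{2}[m]v'K// -comm_iota ?mulgA ?mulVg ?mul1g ?mulgVK//; exact: mv'.
Qed.

Lemma ICom_countable_index U : aut_base (uAut U) ->
  countable_index (ICom U) (@iota_comm G @` U).
Proof.
move=> bU; apply: (@countable_index_normal_closure _ _ (iota_subgroup U) _ (uAut U)).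
- exact: iota_commensurated.
- by exists 1 => //; exact: rho1.
- move=> _ _ [a _ <-] [x Ux <-]; rewrite rho_iota//.
  by exists (a x) => //; exact: aut_in.
- exact: countable_index_uAut bU.
Qed.

(** * The index criterion when the virtual center is trivial *)

Section TrivialVZ.
Hypothesis VZ1 : VZ G = [set 1].

(** An [x] whose conjugation is trivial on an open subgroup has an open centralizer, so it lies in
    [VZ G]. *)
Lemma iota_inj : injective (@iota_comm G).
Proof.
suff ker x : iota_comm x = 1 -> x = 1.
  move=> x y xy; apply: (@mulIg _ y^-1); rewrite mulgV; apply: ker.
  by rewrite iotaM iotaV xy mulgV.
move=> /comm_classP[W [_ _ xW]]; suff : VZ G x by rewrite VZ1.
apply: open_subgroup.
  apply/is_subgroupP; split; first exact: commute1.
  by move=> y z xy xz; apply: commuteM => //; exact: commuteV.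
by apply: filterS (nbhs_os W) => y /xW /= e; rewrite /commute -[in RHS]e mulgVK.
Qed.

Lemma TAut_trivial U : @TAut G U = [set 1].
Proof.
apply/seteqP; split=> [a /rho_eq1 a1|_ ->]; last by apply: subgroup1; exact: TAut_subgroup.
apply: autP => x Ux; apply: iota_inj.
by rewrite aut1E// -rho_iota// a1 mul1g invg1 mulg1.
Qed.

Lemma closed_TAut U : closed (@TAut G U).
Proof.
rewrite TAut_trivial.
exact/accessible_closed_set1/hausdorff_accessible/Aut_hausdorff.
Qed.

(** Injectivity of [iota_comm] transfers multiplicativity from conjugation by [c] to [f]. It also
    makes [f] agree with a representative of [c] near [1], which gives continuity. *)
Lemma conj_iota_hom U (c : Comm G) (f : G -> G) :
  (forall x, os_set U x ->
     os_set U (f x) /\ c * iota_comm x * c^-1 = iota_comm (f x)) ->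
  top_hom U U f.
Proof.
move=> fE; apply: (top_homI Ghccb) => [x /fE[]//|x y Ux Uy|O].
  apply: iota_inj; rewrite iotaM -(fE _ Ux).2 -(fE _ Uy).2 -(fE _ (osM Ux Uy)).2.
  by rewrite iotaM !mulgA mulgVK.
exists (os_preim O (va_hom (repr c))) => x Ux [vx Ox].
rewrite (_ : f x = repr c x)//; apply: iota_inj.
by rewrite -(fE _ Ux).2 -comm_iota// comm_classK.
Qed.

(** Conjugation by [c] permutes [iota U]; read through the injective [iota_comm], it is an
    automorphism of [U], and its class is [c]. *)
Lemma uAut_normalizer U (c : Comm G) :
  [set c * h * c^-1 | h in @iota_comm G @` U] = @iota_comm G @` U -> uAut U c.
Proof.
move=> cU; have ex (d : Comm G) : [set d * h * d^-1 | h in @iota_comm G @` U]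
    `<=` @iota_comm G @` U -> forall x, exists y, os_set U x ->
    os_set U y /\ d * iota_comm x * d^-1 = iota_comm y.
  move=> dU x; have [Ux|//] := pselect (os_set U x); last by exists 1.
  have [|y Uy e] := dU (d * iota_comm x * d^-1); last by exists y.
  by exists (iota_comm x) => //; exists x.
have [|f fE] := choice (ex c _); first by rewrite cU.
have [|g gE] := choice (ex c^-1 _).
  move=> _ [y Uy <-]; rewrite -cU in Uy; case: Uy => _ [x Ux <-] <-.
  by exists x => //; rewrite !mulgA mulVg mul1g invgK mulgVK.
have [|a af] := @mk_aut _ U f g.
  split; [exact: conj_iota_hom fE|exact: conj_iota_hom gE| |] => x Ux; apply: iota_inj.
    have [Uf fx] := fE _ Ux; have [_ <-] := gE _ Uf.
    by rewrite -fx !mulgA mulVg mul1g invgK mulgVK.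
  have [Ug gx] := gE _ Ux; have [_ <-] := fE _ Ug.
  by rewrite -gx invgK !mulgA mulgV mul1g mulgK.
exists a => //; rewrite -[c]comm_classK; apply/comm_classP.
exists (osI U (va_dom (repr c))); split=> x [Ux vx]//=.
rewrite af//; apply: iota_inj.
by rewrite -(fE _ Ux).2 -comm_iota// comm_classK.
Qed.

Section CountableIndex.
Context (U : openSubgroup G).
Hypothesis cU : countable_index (ICom U) (@iota_comm G @` U).

Let J (V : openSubgroup G) (a : Aut V) : set (Comm G) :=
  [set rho a * h * (rho a)^-1 | h in @iota_comm G @` U].

(** If the class of [a] normalizes [iota U], it comes from some automorphism [b] of [U]. Injectivity
    of [iota_comm] makes [b] agree with [a] on [V], so [b] stabilizes [V]. *)
Lemma uAut_stab_conj V (a : Aut V) : V `<=` U ->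
  uAut_stab U V (rho a) <-> J a = @iota_comm G @` U.
Proof.
move=> VU; split=> [[b bV ba]|Ja].
  rewrite /J -ba; apply/seteqP; split=> [_ [_ [x Ux <-] <-]|_ [x Ux <-]].
    by rewrite rho_iota//; exists (b x) => //; exact: aut_in.
  exists (iota_comm (b^-1 x)); first by exists (b^-1 x) => //; exact: aut_in.
  by rewrite rho_iota ?autVK//; exact: aut_in.
have [b _ ba] := uAut_normalizer Ja; exists b => //.
have bE x : os_set V x -> b x = a x.
  move=> Vx; apply: iota_inj; rewrite -(rho_iota a Vx) -(rho_iota b (VU _ Vx)).
  by rewrite ba.
have [_ aV] := char_openT V; rewrite /Aut_stab /= -{2}(aV a).
by apply: eq_imagel => x Vx; exact: bE.
Qed.

Lemma ICom_countable_index_sub V : V `<=` U ->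
  countable_index (ICom U) (@iota_comm G @` V).
Proof.
move=> VU; have fV := @finite_lcosets _ _ V (@compact_os _ Gprof U).
have cF : countable (\bigcup_(Y in [set lcoset z (@iota_comm G @` U) | z in ICom U])
    [set lcoset y (@iota_comm G @` V) | y in Y]).
  apply: bigcup_countable cU _ => _ [z _ <-].
  pose F (Z : set G) := [set z * iota_comm w | w in Z].
  apply: countableW (countable_image F (finite_set_countable fV)).
  move=> _ [_ [_ [x Ux <-] <-] <-]; exists (lcoset x V); first by exists x.
  apply/seteqP; split=> [_ [_ [y Vy <-] <-]|_ [_ [y Vy <-] <-]].
    by exists (iota_comm y); [exists y|rewrite iotaM mulgA].
  by exists (x * y); [exists y|rewrite iotaM mulgA].
apply: countableW cF => _ [z Nz <-].
exists (lcoset z (@iota_comm G @` U)); first by exists z.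
by exists z => //; exact/lcoset_refl/iota_subgroup.
Qed.

(** Since [a] preserves [V], conjugation by [rho a] sends the image of [x V] to a coset of [iota V]
    inside the normal subgroup [ICom U]. Thus each conjugate is a finite union of cosets from a
    countable set. *)
Lemma countable_conj V : V `<=` U -> countable (@J V @` setT).
Proof.
move=> VU; have cV := ICom_countable_index_sub VU.
have fV := @finite_lcosets _ _ V (@compact_os _ Gprof U).
apply: countableW (countable_finite_unions cV) => _ [a _ <-].
pose F (Z : set G) := [set rho a * iota_comm w * (rho a)^-1 | w in Z].
exists (F @` [set lcoset x V | x in os_set U]).
  split; last exact: finite_image.
  move=> _ [_ [x Ux <-] <-]; exists (rho a * iota_comm x * (rho a)^-1).
    have [_ nN] := normal_closure_normal (@iota_comm G @` U).
    by apply: nN; apply: subset_normal_closure; exists x.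
  apply/seteqP; split=> [_ [_ [y Vy <-] <-]|_ [_ [y Vy <-] <-]].
    exists (x * a^-1 y); first by exists (a^-1 y) => //; exact: aut_in.
    rewrite -{2}[y](autVK a)// -rho_iota; last exact: aut_in.
    by rewrite iotaM !mulgA mulgVK.
  exists (iota_comm (a y)); first by exists (a y) => //; exact: aut_in.
  by rewrite -rho_iota// iotaM !mulgA mulgVK.
apply/seteqP; split=> [_ [_ [_ [x Ux <-] <-] [_ [y Vy <-] <-]]|_ [_ [x Ux <-] <-]].
  by exists (iota_comm (x * y)) => //; exists (x * y) => //; exact/osM/VU.
exists (F (lcoset x V)); first by exists (lcoset x V) => //; exists x.
by exists x => //; exact/lcoset_refl/os_subgroup.
Qed.

Lemma Aut_stable_countable_index : Aut_stable U.
Proof.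
move=> V VU; split; first exact: uAut_stab_sub.
pose Q := (@rho G V) @^-1` uAut_stab U V.
have sQ : is_subgroup Q.
  exact/preim_rho_subgroup/rho_image_subgroup/Aut_stab_subgroup.
apply: (@open_countable_index _ (@Aut_nonarchimedean _ Ghccb V) setT Q) => //.
- exact: Aut_compact.
- exact: openT.
- by exists 1.
- apply: closed_preim_rho => //; first exact: closed_TAut.
  by apply: closed_compact_Aut => //; exact: (@os_closed _ (os_Aut_stab Ghccb VU)).
(* Automorphisms with equal conjugates lie in the same coset of [Q], because [(rho a)^-1 * rho b]
   then normalizes [iota U]. *)
apply: countable_image_factor (countable_conj VU) => a b _ _ Jab.
apply/lcoset_eqP => //; apply/uAut_stab_conj => //.
rewrite /J rhoM rhoV.
have cE h : (rho a)^-1 * rho b * h * ((rho a)^-1 * rho b)^-1 =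
    (rho a)^-1 * (rho b * h * (rho b)^-1) * rho a by rewrite invgM invgK !mulgA.
have aK k : (rho a)^-1 * (rho a * k * (rho a)^-1) * rho a = k.
  by rewrite !mulgA mulVg mul1g mulgVK.
apply/seteqP; split=> [_ [h Hh <-]|h Hh].
  have : J b (rho b * h * (rho b)^-1) by exists h.
  by rewrite -Jab cE => -[k Hk <-]; rewrite aK.
have : J a (rho a * h * (rho a)^-1) by exists h.
by rewrite Jab => -[k Hk e]; exists k => //; rewrite cE e aK.
Qed.

End CountableIndex.
End TrivialVZ.
End Iota.

Theorem theorem8p7 (G : topologicalGroupType) (Gprof : profinite G)
    (Ghccb : hccb G) :
  let cond_i := Aut2 G in
  let cond_ii :=
    hausdorff_space (CommA G) /\ locally_compact [set: CommA G] in
  [/\ cond_i <-> cond_ii,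
      cond_i /\ cond_ii -> sigma_compact (CommA G)
    & VZ G = [set 1] ->
      (cond_i /\ cond_ii <->
       exists U : openSubgroup G, countable_index (ICom U) (iota_comm @` U))].
Proof.
move=> cond_i cond_ii.
have i_ii : cond_i -> cond_ii.
  move=> [A1 [U sU]]; split; first exact: CommA_hausdorff sU.
  exact: CommA_locally_compact sU.
split; last move=> VZ1.
- split=> // -[hA lcA]; split; first exact: Aut1_hausdorff.
  by have [U bU] := exists_open_uAut Gprof Ghccb hA lcA; exists U; exact: Aut_stable_open.
- by move=> _; exact: CommA_sigma_compact.
split=> [[[A1 [U sU]] _]|[U cU]].
  by exists U; apply: ICom_countable_index => //; exact: aut_base_uAut.
suff Gi : cond_i by split=> //; exact: i_ii.
split; first by move=> V; exact: closed_TAut.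
by exists U; exact: Aut_stable_countable_index.
Qed.
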